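(* Let $D\subseteq\mathbb{R}$, let $(\Omega,\mathcal{F},P)$ be a probability space, and let $X:D\times\Omega\to\mathbb{R}$ be a centered mean-square continuous stochastic process with $X\in L^2(\Omega\times D)$. There exists a basis $\{e_i\}$ of $L^2(D)$ such that for all $t\in D$, $$X(t,\omega)=\sum_{i=1}^\infty\sqrt{\lambda_i}\,\xi_i(\omega)\,e_i(t)\quad\text{in } L^2(\Omega),$$ where the $\xi_i$ are centered mutually uncorrelated random variables with unit variance and are given by $$\xi_i(\omega)=\frac{1}{\sqrt{\lambda_i}}\int_D X_t(\omega)e_i(t)\,dt.$$ Here $\lambda_i$ denotes the eigenvalue corresponding to $e_i$ of the integral operator $K:L^2(D)\to L^2(D)$, $[Ku](s)=\int_D R_X(s,t)u(t)\,dt$ with $R_X(s,t)=\mathrm{E}[X_sX_t]$; that is, $Ke_i=\lambda_ie_i$. Only the indices $i$ with $\lambda_i>0$ appear in the expansion, and $\xi_i$ is defined for those indices.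
   Context: A stochastic process is a map $X:D\times\Omega\to\mathbb{R}$ such that $X_t:=X(t,\cdot)$ is measurable for every $t\in D$. It is centered if $\mathrm{E}[X_t]=0$ for all $t\in D$, and mean-square continuous if $\lim_{\varepsilon\to0}\mathrm{E}[(X_{t+\varepsilon}-X_t)^2]=0$. $R_X$ is called the autocorrelation function of $X$. $\mathrm{E}[\cdot]$ denotes expectation with respect to $P$, and $L^2(\Omega)=L^2(\Omega,\mathcal{F},P)$ is the real Hilbert space of square integrable random variables, with inner product $\mathrm{E}[XY]$. The basis $\{e_i\}$ is a complete orthonormal set of eigenvectors of $K$, and the eigenvalues $\lambda_i$ are real and non-negative. For an index with $\lambda_i=0$ the coefficient $\int_D X_t e_i(t)\,dt$ is zero, so such terms are absent.
   Formalization: D is taken to be a nonempty Borel set such that every neighbourhood of every point of D meets D in positive Lebesgue measure; without this the claim fails, e.g. for D={0} and X_0 standard normal, where L^2(D)=0 and every integral over D vanishes. *)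

(* Defs.v *)
From HB Require Import structures.
From mathcomp Require Export all_boot all_order all_algebra.
From mathcomp Require Export all_classical all_reals all_analysis.

Set Implicit Arguments.
Unset Strict Implicit.
Unset Printing Implicit Defensive.

Import Order.TTheory GRing.Theory Num.Theory.
Import numFieldNormedType.Exports.

Local Open Scope classical_set_scope.
Local Open Scope ring_scope.

(* L^2(A) for a subset A of a measure space: functions are total, and only
   their restriction to A matters ([u \_ A] is 0 outside A). *)
Definition L2 {d : measure_display} {T : measurableType d} {R : realType}
    (mu : {measure set T -> \bar R}) (A : set T) : set (T -> R) :=
  [set u | u \_ A \in Lfun mu 2%:E].

Definition cvg_L2 {d : measure_display} {T : measurableType d} {R : realType}
    (mu : {measure set T -> \bar R}) (A : set T)
    (u_ : nat -> T -> R) (u : T -> R) : Prop :=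
  [/\ forall n, L2 mu A (u_ n), L2 mu A u &
      'N[mu]_2%:E[EFin \o ((u_ n \- u)%R \_ A)]%E @[n --> \oo] --> 0%E].

Section L2_subset_of_R.
Context {R : realType}.
Local Notation mu := (@lebesgue_measure R).

Definition innerL2 (D : set R) (u v : R -> R) : R :=
  (\int[mu]_(t in D) (u t * v t))%R.

Definition orthonormal_basis (D : set R) (e : nat -> R -> R) : Prop :=
  [/\ forall i, L2 mu D (e i),
      forall i j, innerL2 D (e i) (e j) = (i == j)%:R &
      forall u, L2 mu D u ->
        cvg_L2 mu D (fun n t => \sum_(i < n) innerL2 D u (e i) * e i t) u].

(* Every point of D lies in the support of Lebesgue measure restricted to D.
   Integrals over D do not see the process on a relatively open null subset of
   D (e.g. an isolated point), so an expansion valid at every t in D is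
   impossible without this. *)
Definition in_own_support (D : set R) : Prop :=
  forall t, D t -> forall r : R, 0 < r -> (0 < mu (D `&` ball t r))%E.

End L2_subset_of_R.

Section process.
Context {R : realType} {d : measure_display} {T : measurableType d}.
Variable P : probability T R.
Local Notation mu := (@lebesgue_measure R).
(* A process indexed by D is a function X : R -> T -> R of which only the
   values X t with t in D are used. *)
Implicit Types (D : set R) (X : R -> T -> R).

Definition stochastic_process D X : Prop :=
  forall t, D t -> measurable_fun setT (X t).

Definition centered D X : Prop := forall t, D t -> 'E_P[X t]%E = 0%E.

Definition ms_continuous D X : Prop :=
  forall t, D t ->
    'E_P[fun w => ((X s w - X t w) ^+ 2)%R]%E @[s --> within D (nbhs t)] --> 0%E.

Definition process_L2 D X : Prop :=
  L2 (P \x mu)%E (setT `*` D) (fun wt => X wt.2 wt.1).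

Definition autocorrelation X (s t : R) : R := fine 'E_P[(X s \* X t)%R]%E.

Definition autocorrelation_op D X (u : R -> R) (s : R) : R :=
  (\int[mu]_(t in D) (autocorrelation X s t * u t))%R.

Definition KL_coef D X (lambda : R) (e : R -> R) (w : T) : R :=
  (Num.sqrt lambda)^-1 * (\int[mu]_(t in D) (X t w * e t))%R.

End process.

(* Main.v *)
(* Let [A u = \int_D X_t u(t) dt], from L^2(D) to L^2(Omega), so that [K = A^* A]
   is positive; by Bessel's inequality applied to the paths of [X], the sum of
   [<K f_i, f_i>] over any orthonormal family is at most [E |X|^2].
   This trace bound alone replaces compactness in the spectral theorem: on an
   invariant closed subspace only finitely many orthonormal vectors can have
   Rayleigh quotient at least half the supremum [m], and on their complement
   [m - K] is coercive, so maximizing sequences have Cauchy subsequences.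
   A maximal orthonormal set of eigenvectors (Zorn) is then total, countable
   because countably many indicators of dyadic intervals separate L^2(D), and
   infinite because D contains infinitely many disjoint sets of positive measure.
   Since [K e_i = lambda_i e_i], the vectors [xi_i = A e_i / sqrt lambda_i] are
   orthonormal and [E (X_t xi_i) = sqrt lambda_i e_i(t)], so the expansion of
   [X_t] is its projection on the span of the [xi_i].  Parseval's identity for
   the paths gives [\int_D E X_t^2 dt = sum_i lambda_i], hence the expansion is
   exact for almost every t; mean-square continuity and the support condition
   extend it to every t, projections being contractions. *)
Require Import Defs.
From mathcomp Require Import measurable_realfun ring lra.

Set Implicit Arguments.
Unset Strict Implicit.
Unset Printing Implicit Defensive.

Import Order.TTheory GRing.Theory Num.Theory.
Import numFieldNormedType.Exports.
Local Open Scope classical_set_scope.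
Local Open Scope ring_scope.

(** * Semi-inner products *)

(* Functions are kept as they are instead of being identified almost
   everywhere, so the form may vanish on nonzero vectors. *)
Record semi_inner (R : realType) (V : lmodType R) := SemiInner {
  sip :> V -> V -> R ;
  sipC : forall u v, sip u v = sip v u ;
  sipP : forall a u v w, sip (a *: u + v) w = a * sip u w + sip v w ;
  sip_ge0 : forall u, 0 <= sip u u }.

Definition orthonormal_upto (R : realType) (V : lmodType R)
    (B : semi_inner V) (n : nat) (f : nat -> V) :=
  forall i j, (i < n)%N -> (j < n)%N -> B (f i) (f j) = (i == j)%:R.

Definition sip_cvg (R : realType) (V : lmodType R) (B : semi_inner V)
    (u_ : nat -> V) (u : V) :=
  forall eps : R, 0 < eps ->
    exists N, forall n, (N <= n)%N -> B (u_ n - u) (u_ n - u) < eps.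

Definition sip_complete (R : realType) (V : lmodType R) (B : semi_inner V) :=
  forall u_ : nat -> V,
    (forall eps : R, 0 < eps -> exists N, forall m n, (N <= m)%N -> (N <= n)%N ->
       B (u_ m - u_ n) (u_ m - u_ n) < eps) ->
    exists u, sip_cvg B u_ u.

(** The polynomial is evaluated at its minimum [- b / c]. When [c = 0] it is affine, and unless
    [b = 0] the chosen point gives it the value -1. *)
Lemma discriminant_le (R : realFieldType) (a b c : R) : 0 <= a -> 0 <= c ->
  (forall t, 0 <= a + 2 * b * t + c * t ^+ 2) -> b ^+ 2 <= a * c.
Proof.
move=> a0 c0 h; have [c00|cN0] := eqVneq c 0.
  have [->|bN0] := eqVneq b 0; first by rewrite expr0n/= mulr_ge0.
  have := h (- (a + 1) / (2 * b)); rewrite c00 mul0r addr0.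
  have -> : 2 * b * (- (a + 1) / (2 * b)) = - (a + 1) by field.
  lra.
have cp : 0 < c by rewrite lt_neqAle eq_sym cN0.
have := h (- b / c).
have -> : a + 2 * b * (- b / c) + c * (- b / c) ^+ 2 = (a * c - b ^+ 2) / c.
  by field.
by rewrite pmulr_lge0 ?invr_gt0// subr_ge0.
Qed.

Section semi_inner_theory.
Context (R : realType) (V : lmodType R) (B : semi_inner V).
Implicit Types (u v w : V) (a : R) (f : nat -> V).

Lemma sipDl u v w : B (u + v) w = B u w + B v w.
Proof. by rewrite -{1}[u]scale1r sipP mul1r. Qed.

Lemma sip0l w : B 0 w = 0.
Proof. by have := sipDl 0 0 w; rewrite addr0; lra. Qed.

Lemma sipZl a u w : B (a *: u) w = a * B u w.
Proof. by rewrite -[a *: u]addr0 sipP sip0l addr0. Qed.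

Lemma sipNl u w : B (- u) w = - B u w.
Proof. by rewrite -scaleN1r sipZl mulN1r. Qed.

Lemma sipBl u v w : B (u - v) w = B u w - B v w.
Proof. by rewrite sipDl sipNl. Qed.

Lemma sipDr u v w : B w (u + v) = B w u + B w v.
Proof. by rewrite sipC sipDl !(sipC B w). Qed.

Lemma sipZr a u w : B w (a *: u) = a * B w u.
Proof. by rewrite sipC sipZl sipC. Qed.

Lemma sipNr u w : B w (- u) = - B w u.
Proof. by rewrite sipC sipNl sipC. Qed.

Lemma sipBr u v w : B w (u - v) = B w u - B w v.
Proof. by rewrite sipDr sipNr. Qed.

Lemma sip_suml (I : Type) (r : seq I) (P : pred I) (F : I -> V) w :
  B (\sum_(i <- r | P i) F i) w = \sum_(i <- r | P i) B (F i) w.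
Proof.
by elim/big_rec2 : _ => [|i x y _ <-]; [rewrite sip0l|rewrite sipDl].
Qed.

Lemma sip_sumr (I : Type) (r : seq I) (P : pred I) (F : I -> V) w :
  B w (\sum_(i <- r | P i) F i) = \sum_(i <- r | P i) B w (F i).
Proof. by rewrite sipC sip_suml; apply: eq_bigr => i _; rewrite sipC. Qed.

Lemma sip_sqB u v : B (u - v) (u - v) = B u u - 2 * B u v + B v v.
Proof. by rewrite sipBl !sipBr (sipC B v u); ring. Qed.

Lemma sip_sqD u v : B (u + v) (u + v) = B u u + 2 * B u v + B v v.
Proof. by rewrite sipDl !sipDr (sipC B v u); ring. Qed.

Lemma sip_sqBC u v : B (u - v) (u - v) = B (v - u) (v - u).
Proof. by rewrite !sip_sqB (sipC B v u); ring. Qed.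

Lemma sip_CS u v : B u v ^+ 2 <= B u u * B v v.
Proof.
apply: discriminant_le; rewrite ?sip_ge0// => t.
have := sip_ge0 B (u + t *: v); rewrite sip_sqD !sipZr sipZl.
by congr (0 <= _); ring.
Qed.

(** By Cauchy-Schwarz a null vector pairs to 0 with everything, so vectors at distance 0 can be
    exchanged although the form is degenerate. *)
Lemma sip_null u v : B u u = 0 -> B u v = 0.
Proof.
move=> u0; have := sip_CS u v; rewrite u0 mul0r => h.
by apply/eqP; rewrite -sqrf_eq0 eq_le h sqr_ge0.
Qed.

Lemma sip_sqD_le u v : B (u + v) (u + v) <= 2 * B u u + 2 * B v v.
Proof. by have := sip_ge0 B (u - v); rewrite sip_sqB sip_sqD; lra. Qed.

Lemma sip_sqB_trans u v w :
  B (u - w) (u - w) <= 2 * B (u - v) (u - v) + 2 * B (v - w) (v - w).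
Proof. by have := sip_sqD_le (u - v) (v - w); rewrite addrA subrK. Qed.

Lemma sip_projE n f u i : orthonormal_upto B n f -> (i < n)%N ->
  B (\sum_(j < n) B u (f j) *: f j) (f i) = B u (f i).
Proof.
move=> fo lin; rewrite sip_suml (bigD1 (Ordinal lin))//= sipZl fo// eqxx mulr1.
rewrite big1 ?addr0// => j ji; rewrite sipZl fo//.
case: eqP => [e|]; last by rewrite mulr0.
by move: ji; rewrite -val_eqE/= e eqxx.
Qed.

Lemma sip_sq_proj n f u : orthonormal_upto B n f ->
  B (\sum_(j < n) B u (f j) *: f j) (\sum_(j < n) B u (f j) *: f j)
    = \sum_(j < n) B u (f j) ^+ 2.
Proof.
move=> fo; rewrite sip_sumr; apply: eq_bigr => i _.
by rewrite sipZr (sip_projE _ fo (ltn_ord i)) expr2.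
Qed.

Lemma sip_uproj n f u : orthonormal_upto B n f ->
  B u (\sum_(j < n) B u (f j) *: f j) = \sum_(j < n) B u (f j) ^+ 2.
Proof.
by move=> fo; rewrite sip_sumr; apply: eq_bigr => i _; rewrite sipZr expr2.
Qed.

Lemma sip_sq_residual n f u : orthonormal_upto B n f ->
  B (u - \sum_(j < n) B u (f j) *: f j) (u - \sum_(j < n) B u (f j) *: f j)
    = B u u - \sum_(j < n) B u (f j) ^+ 2.
Proof. by move=> fo; rewrite sip_sqB sip_uproj// sip_sq_proj//; ring. Qed.

Lemma bessel n f u : orthonormal_upto B n f ->
  \sum_(j < n) B u (f j) ^+ 2 <= B u u.
Proof. by move=> fo; rewrite -subr_ge0 -sip_sq_residual// sip_ge0. Qed.

Lemma residual_perp n f u i : orthonormal_upto B n f -> (i < n)%N ->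
  B (u - \sum_(j < n) B u (f j) *: f j) (f i) = 0.
Proof. by move=> fo lin; rewrite sipBl sip_projE// subrr. Qed.

Lemma sip_cvgl (u_ : nat -> V) u v : sip_cvg B u_ u -> forall eps : R, 0 < eps ->
  exists N, forall n, (N <= n)%N -> (B (u_ n) v - B u v) ^+ 2 < eps.
Proof.
move=> uu eps e0; have v0 : 0 < B v v + 1 by have := sip_ge0 B v; lra.
have [N h] := uu (eps / (B v v + 1)) (divr_gt0 e0 v0).
exists N => n /h {}h; rewrite -sipBl; apply: le_lt_trans (sip_CS _ _) _.
have := sip_ge0 B (u_ n - u); move: h; rewrite ltr_pdivlMr// mulrDr mulr1; lra.
Qed.

Lemma sip_cvg_eq (u_ : nat -> V) u v c : sip_cvg B u_ u ->
  (exists N, forall n, (N <= n)%N -> B (u_ n) v = c) -> B u v = c.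
Proof.
move=> uu [N Nc]; apply/eqP; rewrite -subr_eq0 -sqrf_eq0; apply/negPn/negP => h.
have e0 : 0 < (B u v - c) ^+ 2 by rewrite lt_neqAle eq_sym h sqr_ge0.
have [M Mh] := sip_cvgl v uu e0.
have := Mh _ (leq_maxr N M); rewrite Nc ?leq_maxl// -sqrrN opprB ltxx//.
Qed.

Lemma sip_cvg_sq (u_ : nat -> V) u c : sip_cvg B u_ u ->
  (forall n, B (u_ n) (u_ n) = c) -> B u u = c.
Proof.
move=> uu uc; have h v := sip_cvgl v uu.
apply/eqP; rewrite -subr_eq0; apply/negPn/negP => cN.
pose e := `|B u u - c| / 4.
have e0 : 0 < e by rewrite divr_gt0// normr_gt0.
have [N1 h1] := uu _ e0.
have [N2 h2] := h u _ (exprn_gt0 2 e0).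
have {}h1 := h1 _ (leq_maxl N1 N2); have {}h2 := h2 _ (leq_maxr N1 N2).
move: h1 h2; rewrite sip_sqB uc; set x := B (u_ _) u => h1 h2.
(* Since [x] is within [e] of [B u u] and [c - 2 * x + B u u] lies between 0 and [e], the gap
   between [c] and [B u u] is at most [3 * e], while it equals [4 * e] by the choice of [e]. *)
have h3 : `|x - B u u| < e.
  by rewrite -ltr_sqr ?nnegrE ?normr_ge0 ?(ltW e0)// real_normK ?num_real.
have h4 : 0 <= c - 2 * x + B u u.
  by rewrite /x -(uc (maxn N1 N2)) -sip_sqB sip_ge0.
move: h3; rewrite ltr_norml => /andP[h5 h6].
have : `|B u u - c| <= 3 * e by rewrite ler_norml; lra.
have -> : `|B u u - c| = 4 * e by rewrite /e; field.
lra.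
Qed.

End semi_inner_theory.

(** * Spectral theorem for positive operators with bounded trace *)

(** Compactness of the segment from [- M] to [M]. One ultrafilter serves finitely many coordinate
    sequences at once, which replaces repeated extraction of subsequences. *)
Lemma ultra_bounded_cvg (R : realType) (U : set_system nat) (x : nat -> R) (M : R) :
  UltraFilter U -> (forall k, `|x k| <= M) ->
  exists c : R, forall eps : R, 0 < eps -> U [set k | `|x k - c| < eps].
Proof.
move=> UU xM.
have xU : (x @ U) `[- M, M]%classic.
  by apply: (@filterE _ U) => k; rewrite /= in_itv/= -ler_norml xM.
have [c [_ cc]] := @segment_compact R (- M) M (x @ U) _ xU.
exists c => eps e0.
have [//|UC] := in_ultra_setVsetC [set k | `|x k - c| < eps] UU.
have xC : (x @ U) (x @` ~` [set k | `|x k - c| < eps]).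
  by apply: (@filterS _ U _ _ _ _ UC) => k kN; exists k.
have [y [[k kN <-]]] := cc _ (ball c eps) xC (nbhsx_ballx _ _ e0).
by rewrite -ball_normE/= distrC => /kN.
Qed.

Lemma eventually_ultra : exists2 U : set_system nat,
  UltraFilter U & forall N, U [set k | (N <= k)%N].
Proof.
have [U [UU sU]] := @ultraFilterLemma nat \oo _.
by exists U => // N; apply: sU; exact: nbhs_infty_ge.
Qed.

(** * Existence of eigenvectors orthogonal to a set of eigenvectors *)

Section symmetric_operator.
Context (R : realType) (V : lmodType R) (B : semi_inner V) (K : V -> V) (C : R).
Hypothesis Ksym : forall u v, B (K u) v = B u (K v).
Hypothesis Kpos : forall u, 0 <= B (K u) u.
Hypothesis Ktrace : forall n f, orthonormal_upto B n f ->
  \sum_(i < n) B (K (f i)) (f i) <= C.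
Hypothesis Bcomplete : sip_complete B.
Implicit Types (u v e : V) (S : set V).

(** The eigenvalue equation is tested against all vectors, because equality in [V] is finer than
    equality modulo null vectors. *)
Definition eigenvector e (l : R) := forall v, B (K e) v = l * B e v.

Definition perp S : set V := [set u | forall s, S s -> B u s = 0].

(** Positivity of [K] makes this a semi-inner product too, so the expansion of squares and
    Cauchy-Schwarz apply to it. *)
Definition op_form : semi_inner V.
Proof.
exists (fun u v => B (K u) v) => [u v|a u v w|//].
- by rewrite Ksym sipC.
- by rewrite Ksym sipP -!Ksym.
Defined.

Lemma opZ a u : B (K (a *: u)) (a *: u) = a ^+ 2 * B (K u) u.
Proof. by rewrite sipZr Ksym sipZl -Ksym mulrA expr2. Qed.

Lemma op_sqD u v : B (K (u + v)) (u + v) = B (K u) u + 2 * B (K u) v + B (K v) v.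
Proof. exact: (sip_sqD op_form). Qed.

Lemma op_sqB u v : B (K (u - v)) (u - v) = B (K u) u - 2 * B (K u) v + B (K v) v.
Proof. exact: (sip_sqB op_form). Qed.

(** The trace bound for the one-element family consisting of [u] normalized. *)
Lemma op_le u : B (K u) u <= C * B u u.
Proof.
have [u0|uN0] := eqVneq (B u u) 0.
  by rewrite Ksym (sip_null _ u0) u0 mulr0.
have up : 0 < B u u by rewrite lt_neqAle eq_sym uN0 sip_ge0.
pose f (_ : nat) := (Num.sqrt (B u u))^-1 *: u.
have fo : orthonormal_upto B 1 f.
  case=> // -[] // _ _; rewrite sipZl sipZr mulrA -invfM -expr2 sqr_sqrtr ?sip_ge0//.
  by rewrite mulVf.
have := Ktrace fo; rewrite big_ord1 /f opZ exprVn sqr_sqrtr ?sip_ge0//.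
by rewrite ler_pdivrMl// (mulrC C).
Qed.

Lemma op_null u v : B (K u) u = 0 -> B (K u) v = 0.
Proof. exact: (@sip_null _ _ op_form). Qed.

Section invariant_complement.
Context (S : set V).
Hypothesis eigS : forall s, S s -> exists l, eigenvector s l.

Lemma perp_op u : perp S u -> perp S (K u).
Proof.
move=> Mu s Ss; have [l ls] := eigS Ss.
by rewrite Ksym sipC ls sipC Mu// mulr0.
Qed.

Lemma perp_lin a u v : perp S u -> perp S v -> perp S (a *: u + v).
Proof. by move=> Mu Mv s Ss; rewrite sipP Mu// Mv// mulr0 addr0. Qed.

Lemma perp0 : perp S 0.
Proof. by move=> s _; rewrite sip0l. Qed.

Lemma perpZ a u : perp S u -> perp S (a *: u).
Proof. by move=> Mu; have := perp_lin a Mu perp0; rewrite addr0. Qed.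

Lemma perpD u v : perp S u -> perp S v -> perp S (u + v).
Proof. by move=> Mu Mv; have := perp_lin 1 Mu Mv; rewrite scale1r. Qed.

Lemma perpB u v : perp S u -> perp S v -> perp S (u - v).
Proof. by move=> Mu Mv; have := perp_lin (-1) Mv Mu; rewrite scaleN1r addrC. Qed.

Lemma perp_sum n (F : nat -> V) :
  (forall i, (i < n)%N -> perp S (F i)) -> perp S (\sum_(i < n) F i).
Proof.
move=> MF; elim/big_ind : _ => [|u v|i _]; [exact: perp0|exact: perpD|exact: MF].
Qed.

Lemma perp_cvg (u_ : nat -> V) u : (forall n, perp S (u_ n)) -> sip_cvg B u_ u ->
  perp S u.
Proof.
move=> Mu uu s Ss; apply: (sip_cvg_eq uu); exists 0%N => n _; exact: Mu.
Qed.

Section rayleigh.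
Context (mu : R).
Hypothesis mu0 : 0 < mu.
Hypothesis mu_max : forall u, perp S u -> B (K u) u <= mu * B u u.

(** The form of [mu - K]. It is known to be nonnegative only on [perp S], hence is not packed as a
    [semi_inner]. *)
Let Q u v := mu * B u v - B (K u) v.

Let QZ a u : Q (a *: u) (a *: u) = a ^+ 2 * Q u u.
Proof. by rewrite /Q opZ sipZl sipZr; ring. Qed.

Let QD u v : Q (u + v) (u + v) = Q u u + 2 * Q u v + Q v v.
Proof. by rewrite /Q op_sqD sip_sqD; ring. Qed.

Let Q_ge0 u : perp S u -> 0 <= Q u u.
Proof. by move=> /mu_max; rewrite /Q subr_ge0. Qed.

Let QB u v : Q (u - v) (u - v) = Q u u - 2 * Q u v + Q v v.
Proof. by rewrite /Q op_sqB sip_sqB; ring. Qed.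

Let QB_le u v : perp S u -> perp S v -> Q (u - v) (u - v) <= 2 * Q u u + 2 * Q v v.
Proof.
by move=> Mu Mv; have := Q_ge0 (perpD Mu Mv); rewrite QB QD; lra.
Qed.

Let Q_le u : Q u u <= mu * B u u.
Proof. by rewrite /Q; have := Kpos u; lra. Qed.

(** Here [Q u u = 0], so the Cauchy-Schwarz argument for [Q] inside [perp S] gives [Q u x = 0] with
    [x = K u - mu *: u]; but [Q u x = - B x x]. *)
Lemma maximizer_eigenvector u : perp S u -> B (K u) u = mu * B u u ->
  eigenvector u mu.
Proof.
move=> Mu Qu v; pose x := K u - mu *: u.
have Mx : perp S x by apply: perpB; [exact: perp_op|exact: perpZ].
have Qux : Q u x = 0.
  have : Q u x ^+ 2 <= 0 * Q x x.
    apply: discriminant_le; [by []|exact: Q_ge0|move=> t].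
    have := Q_ge0 (perpD Mu (perpZ t Mx)); rewrite QD QZ.
    have -> : Q u (t *: x) = t * Q u x by rewrite /Q !sipZr; ring.
    by rewrite {1}/Q Qu subrr; congr (0 <= _); ring.
  rewrite mul0r => h; apply/eqP; rewrite -sqrf_eq0 eq_le h sqr_ge0//.
have x0 : B x x = 0 by move: Qux; rewrite /Q -sipZl -sipBl -opprB sipNl; lra.
by have := sip_null v x0; rewrite sipBl sipZl; lra.
Qed.

(* A maximal orthonormal family of vectors with Rayleigh quotient at least
   mu / 2 is finite by the trace bound; beyond its span [mu - K] is coercive. *)
Lemma maximal_top_family : exists n f,
  [/\ orthonormal_upto B n f, forall i, (i < n)%N -> perp S (f i) &
      forall v, perp S v -> (forall i, (i < n)%N -> B v (f i) = 0) ->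
        B (K v) v <= mu / 2 * B v v].
Proof.
pose P n := exists f, [/\ orthonormal_upto B n f,
  forall i, (i < n)%N -> perp S (f i) &
  forall i, (i < n)%N -> mu / 2 <= B (K (f i)) (f i)].
have P0 : P 0%N by exists (fun=> 0); split.
(* A family of [N] such vectors has trace at least [N * mu / 2], which exceeds [C] as soon as
   [N > 2 * C / mu]. *)
have [N PN] : exists N, ~ P N.
  have [N hN] : exists N : nat, 2 * C / mu < N%:R.
    by exists (Num.truncn (2 * C / mu)).+1; exact: truncnS_gt.
  exists N => -[f [fo _ fm]]; have := Ktrace fo.
  have : \sum_(i < N) (mu / 2) <= \sum_(i < N) B (K (f i)) (f i).
    by apply: ler_sum => i _; exact: fm.
  rewrite sumr_const card_ord -mulr_natr.
  move: hN; rewrite ltr_pdivrMr//; lra.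
have [n [[f [fo fM fm]] nP]] : exists n, P n /\ ~ P n.+1.
  apply: contrapT => h; apply: PN; elim: N => // n Pn.
  by apply: contrapT => nPn; apply: h; exists n.
(* A vector [v] violating the bound, once normalized, would extend the family to [n.+1] elements. *)
exists n, f; split => // v Mv vf; rewrite leNgt; apply/negP => Kv; apply: nP.
have v0 : 0 < B v v.
  rewrite lt_neqAle sip_ge0 andbT eq_sym; apply/eqP => v0.
  by move: Kv; rewrite Ksym v0 (sip_null _ v0) mulr0 ltxx.
pose c := (Num.sqrt (B v v))^-1.
have cc : c * c = (B v v)^-1 by rewrite -invfM -expr2 sqr_sqrtr// ltW.
exists (fun i => if (i < n)%N then f i else c *: v).
split=> [i j|i _|i _].
- rewrite !ltnS (leq_eqVlt i) (leq_eqVlt j) => /predU1P[->|lin] /predU1P[->|ljn].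
  + by rewrite ltnn eqxx sipZl sipZr mulrA cc mulVf ?gt_eqF.
  + by rewrite ltnn ljn sipZl vf// mulr0 gtn_eqF.
  + by rewrite ltnn lin sipZr sipC vf// mulr0 ltn_eqF.
  + by rewrite lin ljn fo.
- by case: ifPn => [/fM//|_]; exact: perpZ.
- case: ifPn => [/fm//|_]; rewrite opZ expr2 cc.
  by rewrite ler_pdivlMl// mulrC ltW.
Qed.

(** Distances along a maximizing sequence are controlled by finitely many coordinates, which
    converge along an ultrafilter, and by the defects [Q (u_ k) (u_ k)]. A subsequence therefore
    converges, and its limit is a maximizer. *)
Lemma top_eigenvector (u_ : nat -> V) : (forall k, perp S (u_ k)) ->
  (forall k, B (u_ k) (u_ k) = 1) ->
  (forall k, mu - k.+1%:R^-1 <= B (K (u_ k)) (u_ k)) ->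
  exists e, [/\ perp S e, B e e = 1 & eigenvector e mu].
Proof.
move=> uM u1 umax; have [n [f [fo fM ftop]]] := maximal_top_family.
have Qu k : Q (u_ k) (u_ k) <= k.+1%:R^-1.
  by have := umax k; rewrite /Q u1; move: (_^-1) => r; lra.
(* Split [d = w + v] orthogonally. Coercivity on [v] gives [mu / 2 * B v v <= Q v v <= 2 * Q d d + 2
   * Q w w], where [Q d d] is at most twice the sum of the two defects and [Q w w <= mu * B w w].
   Adding [B w w] to the bound on [B v v] yields the constants 5 and 8. *)
have dist k l : B (u_ k - u_ l) (u_ k - u_ l) <=
    5 * (\sum_(i < n) (B (u_ k) (f i) - B (u_ l) (f i)) ^+ 2) +
    8 / mu * (k.+1%:R^-1 + l.+1%:R^-1).
  set d := u_ k - u_ l; pose w := \sum_(i < n) B d (f i) *: f i.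
  pose v := d - w.
  have Md : perp S d by exact: perpB.
  have Mw : perp S w.
    by apply: (@perp_sum n (fun i => B d (f i) *: f i)) => i /fM; exact: perpZ.
  have Mv : perp S v by exact: perpB.
  have vf i : (i < n)%N -> B v (f i) = 0 by exact: residual_perp.
  have Bv := sip_sq_residual d fo; rewrite -/w -/v in Bv.
  have Bw := sip_sq_proj d fo; rewrite -/w in Bw.
  have -> : \sum_(i < n) (B (u_ k) (f i) - B (u_ l) (f i)) ^+ 2
      = \sum_(i < n) B d (f i) ^+ 2 by under [RHS]eq_bigr do rewrite sipBl.
  move: Bv Bw; set s := \sum_(i < n) _ => Bv Bw.
  have h1 := ftop v Mv vf.
  have h2 := QB_le Md Mw; rewrite -/v in h2.
  have h3 := QB_le (uM k) (uM l); rewrite -/d in h3.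
  have h4 := Q_le w; have h5 := Qu k; have h6 := Qu l.
  set r := k.+1%:R^-1 + l.+1%:R^-1.
  have h7 : mu * B d d <= mu * (5 * s) + 8 * r.
    move: h1 h2 h3 h4 h5 h6; rewrite {1}/Q Bv Bw /r.
    by move: (k.+1%:R^-1) (l.+1%:R^-1) => a b; lra.
  rewrite -(ler_pM2l mu0) mulrDr (le_trans h7)// lerD2l.
  by rewrite mulrA mulrCA divff ?mulr1// gt_eqF.
have [U UU Uge] := eventually_ultra.
have /choice[c cP] (i : 'I_n) : exists c, forall eps : R, 0 < eps ->
    U [set k | `|B (u_ k) (f i) - c| < eps].
  apply: ultra_bounded_cvg 1 UU _ => k.
  rewrite -(@ler_pXn2r _ 2)// ?nnegrE// real_normK ?num_real// expr1n.
  have := bessel (u_ k) fo; rewrite u1 (bigD1 i)//=.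
  by have := @sumr_ge0 R _ (index_enum 'I_n) (fun j => j != i)
    (fun j => B (u_ k) (f j) ^+ 2) (fun j _ => sqr_ge0 _); lra.
have cauchy (eps : R) : 0 < eps -> exists2 A, U A & forall k l, A k -> A l ->
    B (u_ k - u_ l) (u_ k - u_ l) < eps.
  move=> e0.
  (* As [del <= 1], squares are bounded by [del], so the coordinate sum is at most [eps / 20] and
     contributes [eps / 4]; the defects contribute less than [eps / 2]. The successor of [n] covers
     an empty family. *)
  pose del := Num.min 1 (eps / (20 * n.+1%:R)).
  have n0 : 0 < 20 * n.+1%:R :> R by rewrite mulr_gt0.
  have del0 : 0 < del by rewrite /del lt_min ltr01 divr_gt0.
  have [N hN] : exists N : nat, 32 / (mu * eps) < N%:R.
    by exists (Num.truncn (32 / (mu * eps))).+1; exact: truncnS_gt.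
  exists ([set k | forall i : 'I_n, `|B (u_ k) (f i) - c i| < del / 2] `&`
          [set k | (N <= k)%N]).
    apply: filterI; last exact: Uge.
    by apply: filter_forall => i; apply: cP; rewrite divr_gt0.
  move=> k l [/= kc Nk] [lc Nl]; apply: le_lt_trans (dist k l) _.
  have Ninv m : (N <= m)%N -> m.+1%:R^-1 < mu * eps / 32.
    move=> Nm; rewrite -[ltRHS]invrK ltf_pV2 ?posrE ?invr_gt0 ?divr_gt0 ?mulr_gt0//.
    by rewrite invf_div (lt_le_trans hN)// ler_nat ltnW.
  have h1 : 8 / mu * (k.+1%:R^-1 + l.+1%:R^-1) < eps / 2.
    rewrite -(ltr_pM2l mu0) mulrA mulrCA divff ?gt_eqF// mulr1.
    have := Ninv _ Nk; have := Ninv _ Nl.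
    by move: (k.+1%:R^-1) (l.+1%:R^-1) => a b; lra.
  suff h2 : \sum_(i < n) (B (u_ k) (f i) - B (u_ l) (f i)) ^+ 2 <= eps / 20.
    by move: h1; move: (8 / mu * _) => a; lra.
  apply: (@le_trans _ _ (\sum_(i < n) (eps / (20 * n.+1%:R)))).
    apply: ler_sum => i _; apply: (@le_trans _ _ del); last by rewrite ge_min lexx orbT.
    have del1 : del <= 1 by rewrite ge_min lexx.
    have : `|B (u_ k) (f i) - B (u_ l) (f i)| <= del.
      have := kc i; have := lc i; rewrite !ltr_norml ler_norml.
      by move=> /andP[? ?] /andP[? ?]; apply/andP; split; lra.
    rewrite -real_normK ?num_real// => h.
    apply: le_trans (_ : del * del <= _); first by rewrite expr2 ler_pM.
    by rewrite ger_pMr.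
  rewrite sumr_const card_ord -[leLHS]mulr_natr invfM mulrA -[leLHS]mulrA.
  by rewrite ger_pMr ?divr_gt0// ler_pdivrMl ?ltr0n// mulr1 ler_nat.
have /choice[A AP] (j : nat) : exists A : set nat, U A /\ forall k l, A k -> A l ->
    B (u_ k - u_ l) (u_ k - u_ l) < j.+1%:R^-1.
  by have [A ? ?] := cauchy j.+1%:R^-1 (ltac:(by rewrite invr_gt0)); exists A.
(* Diagonal selection: finite intersections of members of [U] are nonempty. The indices [sel j] need
   not increase; [j <= sel j] suffices. *)
have /choice[sel selP] (j : nat) : exists k, (j <= k)%N /\ forall i, (i <= j)%N -> A i k.
  have : U ([set k | (j <= k)%N] `&` [set k | forall i : 'I_j.+1, A i k]).
    apply: filterI; first exact: Uge.
    by apply: filter_forall => i; exact: (AP i).1.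
  move=> /filter_ex[k [/= jk Ak]]; exists k; split => // i ij.
  by have := Ak (Ordinal (ij : (i < j.+1)%N)).
have small (eps : R) : 0 < eps ->
    exists N : nat, forall j, (N <= j)%N -> j.+1%:R^-1 < eps.
  move=> e0; exists (Num.truncn eps^-1) => j Nj.
  rewrite -[eps]invrK ltf_pV2 ?posrE ?invr_gt0//.
  by rewrite (lt_le_trans (truncnS_gt _))// ler_nat ltnS.
have [e ue] := Bcomplete (u_ := u_ \o sel) (ltac:(
  move=> eps /small[N Ne]; exists N => m p Nm Np;
  apply: lt_trans (Ne N (leqnn _)); apply: (AP N).2;
  exact: (selP _).2)).
exists e.
have Me : perp S e by apply: perp_cvg ue => j; exact: uM.
have Be : B e e = 1 by apply: (sip_cvg_sq ue) => j; exact: u1.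
split => //; apply: maximizer_eigenvector => //.
(* Writing [e] as [u_ k - (u_ k - e)] bounds [Q e e] by [2 * Q (u_ k) (u_ k)] plus [2 * mu] times
   the squared distance from [u_ k] to [e]; if [Q e e] were positive, each of the two terms could be
   made less than half of it. *)
suff : Q e e <= 0 by have := Q_ge0 Me; rewrite /Q; lra.
rewrite leNgt; apply/negP => Qe.
have Q0 : 0 < Q e e / 4 by rewrite divr_gt0.
have [N1 h1] := small _ Q0.
have [N2 h2] := ue _ (divr_gt0 Q0 mu0).
have {}h2 := h2 _ (leq_maxr N1 N2); set j := maxn N1 N2 in h2.
have h4 : Q (u_ (sel j)) (u_ (sel j)) < Q e e / 4.
  apply: le_lt_trans (Qu (sel j)) _.
  by apply: h1; rewrite (leq_trans _ (selP j).1)// leq_maxl.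
have h5 := QB_le (uM (sel j)) (perpB (uM (sel j)) Me).
have h6 := Q_le (u_ (sel j) - e).
move: h2; rewrite ltr_pdivlMr//= mulrC => h2.
have h7 : u_ (sel j) - (u_ (sel j) - e) = e by rewrite opprB addrCA subrr addr0.
rewrite h7 in h5.
lra.
Qed.

End rayleigh.

(** If the quadratic form of [K] vanishes on the complement, any unit vector there has eigenvalue 0.
    Otherwise the supremum of the Rayleigh quotient is positive, finite by [op_le], and attained. *)
Lemma exists_eigenvector u0 : perp S u0 -> 0 < B u0 u0 ->
  exists e l, [/\ perp S e, B e e = 1 & eigenvector e l].
Proof.
have normalize u : 0 < B u u ->
    B ((Num.sqrt (B u u))^-1 *: u) ((Num.sqrt (B u u))^-1 *: u) = 1.
  move=> u0'; rewrite sipZl sipZr mulrA -invfM -expr2 sqr_sqrtr ?sip_ge0//.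
  by rewrite mulVf// gt_eqF.
move=> Mu0 u00.
have [K0|] := pselect (forall u, perp S u -> B (K u) u = 0).
  exists ((Num.sqrt (B u0 u0))^-1 *: u0), 0; split.
  - exact: perpZ.
  - exact: normalize.
  - by move=> v; rewrite mul0r; apply: op_null; apply: K0; exact: perpZ.
move=> /existsNP[u1 /not_implyP[Mu1 /eqP Ku1]].
pose E := [set r | exists u, [/\ perp S u, B u u = 1 & r = B (K u) u]].
have Ku1p : 0 < B (K u1) u1 by rewrite lt_neqAle eq_sym Ku1 Kpos.
have u1p : 0 < B u1 u1.
  rewrite lt_neqAle sip_ge0 andbT eq_sym; apply/eqP => h.
  by move: Ku1p; rewrite Ksym (sip_null _ h) ltxx.
have E1 : E (B (K u1) u1 / B u1 u1).
  exists ((Num.sqrt (B u1 u1))^-1 *: u1); split; first exact: perpZ.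
  - exact: normalize.
  - by rewrite opZ exprVn sqr_sqrtr ?sip_ge0// mulrC.
have supE : has_sup E.
  split; first by eexists; exact: E1.
  exists C => r [u [_ u1' ->]]; have := op_le u; rewrite u1' mulr1//.
have mu0 : 0 < sup E.
  by apply: lt_le_trans (ub_le_sup supE.2 E1); rewrite divr_gt0.
have mu_max u : perp S u -> B (K u) u <= sup E * B u u.
  move=> Mu; have [u0'|uN0] := eqVneq (B u u) 0.
    by rewrite Ksym (sip_null _ u0') u0' mulr0.
  have up : 0 < B u u by rewrite lt_neqAle eq_sym uN0 sip_ge0.
  rewrite -ler_pdivrMr//; apply: (ub_le_sup supE.2).
  exists ((Num.sqrt (B u u))^-1 *: u); split; first exact: perpZ.
  - exact: normalize.
  - by rewrite opZ exprVn sqr_sqrtr ?sip_ge0// mulrC.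
have /choice[u_ uP] (k : nat) : exists u, [/\ perp S u, B u u = 1 &
    sup E - k.+1%:R^-1 <= B (K u) u].
  have [r [u [Mu u1' ->]] h] := @sup_adherent _ E k.+1%:R^-1 (ltac:(by [])) supE.
  by exists u; split => //; exact: ltW.
have [e [Me e1 eE]] := top_eigenvector mu0 mu_max (fun k => let: And3 h _ _ := uP k in h)
  (fun k => let: And3 _ h _ := uP k in h) (fun k => let: And3 _ _ h := uP k in h).
by exists e, (sup E).
Qed.

End invariant_complement.
End symmetric_operator.

(** * Cardinality and totality of orthonormal sets *)

Lemma enum_card_eq (T : Type) (x0 : T) (A : set T) (I : set nat) :
  (A #= I)%card -> exists f : nat -> T, set_bij I A f.
Proof.
elim/Ppointed: T => T in x0 A *; first by have := no x0.
by move=> /card_esym/card_set_bijP.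
Qed.

Lemma infinite_injective_seq (T : Type) (A : set T) : infinite_set A ->
  exists2 f : nat -> T, injective f & forall n, A (f n).
Proof.
elim/Ppointed: T => T in A *; first by rewrite empty_eq0.
move=> /infiniteP/pcard_leP[f]; exists f; first by move=> i j; apply: inj; rewrite inE.
by move=> n; exact: funS.
Qed.

Section orthonormal_sets.
Context (R : realType) (V : lmodType R) (B : semi_inner V).
Implicit Types (u v e : V) (S : set V).

Definition orthonormal_set S :=
  forall s t, S s -> S t -> B s t = `[< s = t >]%:R.

Lemma orthonormal_set_seq S (f : nat -> V) n : orthonormal_set S ->
  (forall i, (i < n)%N -> S (f i)) ->
  (forall i j, (i < n)%N -> (j < n)%N -> f i = f j -> i = j) ->
  orthonormal_upto B n f.
Proof.
move=> oS fS finj i j lin ljn; rewrite oS; [|exact: fS|exact: fS].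
congr (_%:R); have [->|ij] := eqVneq i j; first by rewrite asboolT.
by rewrite asboolF// => /(finj _ _ lin ljn)/eqP; rewrite (negPf ij).
Qed.

(** Every element of [S] has a nonzero coefficient against some [g q], and by Bessel only finitely
    many have a squared coefficient above a given threshold. *)
Lemma orthonormal_set_countable S (g : nat -> V) : orthonormal_set S ->
  (forall u, (forall q, B u (g q) = 0) -> B u u = 0) -> countable S.
Proof.
move=> oS gsep.
pose F (qn : nat * nat) := [set s | S s /\ qn.2.+1%:R^-1 < B (g qn.1) s ^+ 2].
have SF : S `<=` \bigcup_(qn in [set: nat * nat]) F qn.
  move=> s Ss; apply: contrapT => h.
  have /gsep : forall q, B s (g q) = 0.
    move=> q; apply/eqP; rewrite -sqrf_eq0; apply/negPn/negP => sq.
    apply: h; exists (q, Num.truncn (B s (g q) ^+ 2)^-1) => //; split => //=.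
    rewrite sipC -[ltRHS]invrK ltf_pV2 ?posrE ?ltr0Sn//.
      by rewrite sipC; exact: truncnS_gt.
    by rewrite invr_gt0 lt_neqAle eq_sym sipC sq sqr_ge0.
  by rewrite oS// asboolT// => /eqP; rewrite oner_eq0.
apply: (sub_countable (subset_card_le SF)); apply: bigcup_countable => // -[q n] _.
apply: finite_set_countable; apply: contrapT => /infinite_injective_seq[f finj fF].
(* Chosen so that [N] terms larger than [n.+1%:R^-1] add up to more than the squared norm of
   [g q]. *)
pose N := (Num.truncn (B (g q) (g q) * n.+1%:R)).+1.
have fo : orthonormal_upto B N f.
  apply: (@orthonormal_set_seq S) => // [i _|i j _ _]; first exact: (fF i).1.
  exact: finj.
have := bessel (g q) fo; apply/negP; rewrite -ltNge.
apply: (@lt_le_trans _ _ (\sum_(i < N) n.+1%:R^-1)); last first.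
  by apply: ler_sum => i _; exact/ltW/(fF i).2.
by rewrite sumr_const card_ord -[ltRHS]mulr_natl ltr_pdivlMr// truncnS_gt.
Qed.

(** Double counting: if [S] had [n] elements, the squared coefficients of [n.+1] orthonormal vectors
    would sum to [n.+1] by Parseval over [S], and to at most [n] by Bessel the other way. *)
Lemma orthonormal_set_infinite S : orthonormal_set S ->
  (forall u, perp B S u -> B u u = 0) ->
  (forall n, exists h, orthonormal_upto B n h) -> infinite_set S.
Proof.
move=> oS Stot hn /finite_setP[n /(enum_card_eq 0)[f [fS finj fsurj]]].
have fo : orthonormal_upto B n f.
  apply: (@orthonormal_set_seq S) => // i j lin ljn.
  by apply: finj; rewrite inE.
have [h ho] := hn n.+1.
have parseval k : (k < n.+1)%N -> \sum_(i < n) B (h k) (f i) ^+ 2 = 1.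
  move=> kn; have := sip_sq_residual (h k) fo; rewrite Stot.
    by rewrite ho// eqxx/= mulr1n; lra.
  by move=> s /fsurj[i lin <-]; exact: residual_perp.
have : \sum_(k < n.+1) \sum_(i < n) B (h k) (f i) ^+ 2 = n.+1%:R.
  rewrite (eq_bigr (fun=> 1)) ?sumr_const ?card_ord// => k _.
  exact: parseval.
rewrite exchange_big/= => E.
have : \sum_(j < n) \sum_(i < n.+1) B (h i) (f j) ^+ 2 <= n%:R.
  apply: (@le_trans _ _ (\sum_(j < n) 1)); last by rewrite sumr_const card_ord.
  apply: ler_sum => j _; have := bessel (f j) ho.
  rewrite fo// eqxx; apply: le_trans.
  by under eq_bigr do rewrite sipC.
by rewrite E ler_nat ltnn.
Qed.

(** Bessel makes the partial sums Cauchy; their limit has the same coefficients as [u], so totality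
    puts it at distance 0 from [u]. *)
Lemma total_orthonormal_cvg (e : nat -> V) : sip_complete B ->
  (forall i j, B (e i) (e j) = (i == j)%:R) ->
  (forall u, (forall i, B u (e i) = 0) -> B u u = 0) ->
  forall u, sip_cvg B (fun n => \sum_(i < n) B u (e i) *: e i) u.
Proof.
move=> Bc eo etot u.
have eon n : orthonormal_upto B n e by move=> i j _ _; exact: eo.
pose s n := \sum_(i < n) B u (e i) ^+ 2.
pose p n := \sum_(i < n) B u (e i) *: e i.
have sq n : B (p n) (p n) = s n by exact: sip_sq_proj.
have spB m n : (m <= n)%N -> B (p n - p m) (p n - p m) = s n - s m.
  move=> mn; rewrite sip_sqB !sq.
  suff -> : B (p n) (p m) = s m by ring.
  rewrite sip_sumr; apply: eq_bigr => i _; rewrite sipZr sip_projE//.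
  by rewrite (leq_trans (ltn_ord i)).
have snd : {homo s : m n / (m <= n)%N >-> m <= n}.
  by move=> m n mn; rewrite -subr_ge0 -spB// sip_ge0.
have scv : cvgn s.
  apply: nondecreasing_is_cvgn => //.
  by exists (B u u) => _ [n _ <-]; exact: bessel.
have pc (eps : R) : 0 < eps -> exists N, forall m n, (N <= m)%N -> (N <= n)%N ->
    B (p m - p n) (p m - p n) < eps.
  move=> e0; have e20 : 0 < eps / 2 by rewrite divr_gt0.
  have /cvgrPdist_lt /(_ _ e20) [N _ hN] := scv.
  exists N => m n Nm Nn; wlog mn : m n Nm Nn / (m <= n)%N.
    by move=> h; have [/h->//|/ltnW/h] := leqP m n; rewrite sip_sqBC; exact.
  rewrite sip_sqBC spB//; have := hN _ Nm; have := hN _ Nn.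
  by rewrite /= !ltr_norml => /andP[? ?] /andP[? ?]; lra.
have [q pq] := Bc _ pc.
have qu : B (q - u) (q - u) = 0.
  apply: etot => i; rewrite sipBl; apply/eqP; rewrite subr_eq0; apply/eqP.
  apply: (sip_cvg_eq pq); exists i.+1 => n ni; exact: sip_projE.
move=> eps e0; have [N hN] := pq (eps / 2) (divr_gt0 e0 (ltr0Sn _ _)).
exists N => n /hN {}hN; have := sip_sqB_trans B (p n) q u.
by rewrite qu mulr0 addr0; move: hN; rewrite -/(p n); lra.
Qed.

End orthonormal_sets.

(** * Orthonormal eigenbases *)

Section spectral_theorem.
Context (R : realType) (V : lmodType R) (B : semi_inner V) (K : V -> V) (C : R).
Hypothesis Ksym : forall u v, B (K u) v = B u (K v).
Hypothesis Kpos : forall u, 0 <= B (K u) u.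
Hypothesis Ktrace : forall n f, orthonormal_upto B n f ->
  \sum_(i < n) B (K (f i)) (f i) <= C.
Hypothesis Bcomplete : sip_complete B.

Lemma maximal_eigenset : exists S, [/\ orthonormal_set B S,
  forall s, S s -> exists l, eigenvector B K s l &
  forall u, perp B S u -> B u u = 0].
Proof.
pose P := [set S | orthonormal_set B S /\
  forall s, S s -> exists l, eigenvector B K s l].
have [F FP Ftot|S [[oS eS] Smax]] := @Zorn_bigcup V P.
  split=> [s t [X FX Xs] [Y FY Yt]|s [X /FP[_ eX] /eX//]].
  have [XY|YX] := Ftot _ _ FX FY.
  - by apply: (FP _ FY).1 => //; exact: XY.
  - by apply: (FP _ FX).1 => //; exact: YX.
exists S; split => // u Su; apply/eqP; rewrite eq_le sip_ge0 andbT leNgt.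
apply/negP => u0.
have [e [l [Se e1 el]]] := exists_eigenvector Ksym Kpos Ktrace Bcomplete eS Su u0.
have nSe : ~ S e.
  by move=> /Se; rewrite e1 => /eqP; rewrite oner_eq0.
apply: (Smax (S `|` [set e])).
  by split; [move=> s; left|move=> /(_ e) h; apply: nSe; apply: h; right].
split=> [s t [Ss|->] [St|->]|s [/eS//|->]]; last by exists l.
- exact: oS.
- by rewrite sipC Se// asboolF// => se; apply: nSe; rewrite -se.
- by rewrite Se// asboolF// => se; apply: nSe; rewrite se.
- by rewrite e1 asboolT.
Qed.

Lemma eigenbasis (g : nat -> V) :
  (forall u, (forall q, B u (g q) = 0) -> B u u = 0) ->
  (forall n, exists h, orthonormal_upto B n h) ->
  exists (e : nat -> V) (lambda : nat -> R),
    [/\ forall i j, B (e i) (e j) = (i == j)%:R,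
        forall u, sip_cvg B (fun n => \sum_(i < n) B u (e i) *: e i) u,
        forall i, 0 <= lambda i &
        forall i, eigenvector B K (e i) (lambda i)].
Proof.
move=> gsep hinf; have [S [oS eS Stot]] := maximal_eigenset.
have /(enum_card_eq 0)[e [eSS einj esurj]] : (S #= [set: nat])%card.
  apply: eq_card_nat; first exact: orthonormal_set_countable gsep.
  exact: (orthonormal_set_infinite oS).
have {}eSS i : S (e i) by exact: eSS.
have {}einj : injective e by move=> i j; apply: einj; rewrite inE.
have eo i j : B (e i) (e j) = (i == j)%:R.
  rewrite oS//; congr (_%:R); have [->|ij] := eqVneq i j; first by rewrite asboolT.
  by rewrite asboolF// => /einj/eqP; rewrite (negPf ij).
have /choice[lambda lP] i : exists l, eigenvector B K (e i) l by exact: eS.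
exists e, lambda; split => //.
  apply: total_orthonormal_cvg => // u ue; apply: Stot => s /esurj[i _ <-].
  exact: ue.
by move=> i; have := Kpos (e i); rewrite lP eo eqxx mulr1.
Qed.

End spectral_theorem.

(** * Square-integrable functions *)

Local Notation sqfun mu := (LfunType mu (lee1n 2)).

Section square_integrable.
Context (d : measure_display) (T : measurableType d) (R : realType)
  (mu : {measure set T -> \bar R}).
Implicit Types (f g : T -> R) (D : set T).

Lemma Lfun_measurable (p : \bar R) f : f \in Lfun mu p -> measurable_fun setT f.
Proof. by rewrite inE => /andP[]; rewrite inE. Qed.

Lemma Lnorm2_sqr f :
  ('N[mu]_2%:E[EFin \o f] `^ 2 = \int[mu]_x (f x ^+ 2)%:E)%E.
Proof.
rewrite poweR_Lnorm//; apply: eq_integral => x _.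
by rewrite /= powR_mulrn// real_normK// num_real.
Qed.

Lemma Lfun2P f : f \in Lfun mu 2%:E <->
  measurable_fun setT f /\ (\int[mu]_x (f x ^+ 2)%:E < +oo)%E.
Proof.
split=> [f2|[mf f2]].
  split; first exact: Lfun_measurable f2.
  rewrite -Lnorm2_sqr poweR_lty//.
  by move: f2; rewrite inE => /andP[_]; rewrite inE.
rewrite inE; apply/andP; split; rewrite inE//= /finite_norm.
by rewrite (@lty_poweRy _ _ 2)// Lnorm2_sqr.
Qed.

Lemma Lfun2_integrableM f g : f \in Lfun mu 2%:E -> g \in Lfun mu 2%:E ->
  mu.-integrable setT (fun x => (f x * g x)%:E).
Proof. by move=> f2 g2; apply/Lfun1_integrable; exact: Lfun2_mul_Lfun1. Qed.

Lemma sqfun_integrableM D (u v : sqfun mu) : measurable D ->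
  mu.-integrable D (fun x => (u x * v x)%:E).
Proof.
move=> mD; apply: (integrableS measurableT) => //.
by apply: Lfun2_integrableM; exact: LfunP.
Qed.

Lemma sqfunD (u v : sqfun mu) x : (u + v) x = u x + v x.
Proof. by []. Qed.

Lemma sqfunZ a (u : sqfun mu) x : (a *: u) x = a * u x.
Proof. by []. Qed.

Lemma sqfunB (u v : sqfun mu) x : (u - v) x = u x - v x.
Proof. by []. Qed.

Lemma sqfun_sum (I : Type) (r : seq I) (P : pred I) (F : I -> sqfun mu) x :
  (\sum_(i <- r | P i) F i) x = \sum_(i <- r | P i) F i x.
Proof. by elim/big_rec2 : _ => // i a b _ <-. Qed.

(** Vectors are square integrable on the whole space while only [D] is integrated over, so their
    values outside [D] are invisible to the form. *)
Definition L2form D (mD : measurable D) : semi_inner (sqfun mu).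
Proof.
apply: (@SemiInner R (sqfun mu)
  (fun u v : sqfun mu => \int[mu]_(x in D) (u x * v x))) => [u v|a u v w|u].
- by apply: eq_Rintegral => x _; rewrite mulrC.
- rewrite -RintegralZl//; last exact: sqfun_integrableM.
  rewrite -RintegralD//.
  + by apply: eq_Rintegral => x _; rewrite sqfunD sqfunZ mulrDl mulrA.
  + have := @sqfun_integrableM _ (a *: u) w mD.
    by apply: eq_integrable => // x _; rewrite sqfunZ/= mulrA.
  + exact: sqfun_integrableM.
- by apply: Rintegral_ge0 => x _; rewrite -expr2 sqr_ge0.
Defined.

Lemma L2formE D (mD : measurable D) (u v : sqfun mu) :
  (L2form mD u v)%:E = (\int[mu]_(x in D) (u x * v x)%:E)%E.
Proof.
rewrite /= /Rintegral fineK//.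
by apply: integrable_fin_num => //; exact: sqfun_integrableM.
Qed.

Lemma L2form_sqrE D (mD : measurable D) (u : sqfun mu) :
  (L2form mD u u)%:E = (\int[mu]_(x in D) (u x ^+ 2)%:E)%E.
Proof. by rewrite L2formE; apply: eq_integral => x _; rewrite expr2. Qed.

Lemma L2form_eq0P D (mD : measurable D) (u : sqfun mu) :
  L2form mD u u = 0 <-> {ae mu, forall x, D x -> u x = 0}.
Proof.
have mu2 : measurable_fun D (fun x => (u x ^+ 2)%:E).
  by apply/measurable_EFinP; apply: measurable_funX; exact: measurable_funTS.
have -> : L2form mD u u = 0 <-> (\int[mu]_(x in D) `|(u x ^+ 2)%:E| = 0)%E.
  have -> : (\int[mu]_(x in D) `|(u x ^+ 2)%:E| = (L2form mD u u)%:E)%E.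
    rewrite L2form_sqrE; apply: eq_integral => x _.
    by rewrite gee0_abs// lee_fin sqr_ge0.
  by split=> [->//|[]].
split=> [/(ae_eq_integral_abs _ mD mu2)|u0].
  by apply: filterS => x h /h -[] /eqP; rewrite sqrf_eq0 => /eqP.
apply/(ae_eq_integral_abs _ mD mu2); move: u0.
by apply: filterS => x h /h ->; rewrite expr0n.
Qed.

Lemma Lfun2D f g : f \in Lfun mu 2%:E -> g \in Lfun mu 2%:E ->
  (fun x => f x + g x) \in Lfun mu 2%:E.
Proof. by move=> f2 g2; have [_ /(_ _ _ f2 g2)] := Lfun_addr_closed mu (lee1n 2). Qed.

Lemma Lfun2_restrict f D : measurable D -> f \in Lfun mu 2%:E ->
  f \_ D \in Lfun mu 2%:E.
Proof.
move=> mD /Lfun2P[mf f2]; apply/Lfun2P; split.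
  by apply/(measurable_restrictT _ mD); exact: measurable_funTS.
apply: le_lt_trans f2; apply: ge0_le_integral => //.
- by move=> x _; rewrite lee_fin sqr_ge0.
- apply/measurable_EFinP; apply: measurable_funX.
  by apply/(measurable_restrictT _ mD); exact: measurable_funTS.
- exact/measurable_EFinP/measurable_funX.
- move=> x _; rewrite lee_fin patchE; case: ifPn => // _.
  by rewrite expr0n/= sqr_ge0.
Qed.

End square_integrable.

Lemma limn_einf_le (R : realType) (u : (\bar R)^nat) (c : \bar R) :
  (exists N, forall n, (N <= n)%N -> (u n <= c)%E) -> (limn_einf u <= c)%E.
Proof.
move=> [N uc]; rewrite limn_einf_lim; apply: lime_le; first exact: is_cvg_einfs.
apply: nearW => n; apply: le_trans (uc _ (leq_maxr n N)).
by apply: ereal_inf_lbound; exists (maxn n N) => //=; exact: leq_maxl.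
Qed.

(** The increments are dominated by the geometric series with ratio 1/2 and first term the square
    root of [M]. *)
Lemma cvg_geometric_increments (R : realType) (a : nat -> R) (M : R) :
  (forall k, 4 ^+ k * (a k.+1 - a k) ^+ 2 <= M) -> cvgn a.
Proof.
move=> aM; have M0 : 0 <= M by apply: le_trans (aM 0%N); rewrite mul1r sqr_ge0.
pose inc k := a k.+1 - a k.
have incle k : `|inc k| <= geometric (Num.sqrt M) 2^-1 k.
  rewrite /geometric/=.
  have q0 : 0 <= Num.sqrt M * 2^-1 ^+ k.
    by rewrite mulr_ge0 ?sqrtr_ge0// exprn_ge0// invr_ge0.
  rewrite -(@ler_pXn2r _ 2) ?nnegrE// real_normK ?num_real//.
  rewrite exprMn sqr_sqrtr// -exprM mulnC exprM.
  have -> : (2^-1 : R) ^+ 2 = 4^-1 by rewrite expr2 -invfM; congr (_^-1); ring.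
  by rewrite exprVn ler_pdivlMr ?exprn_gt0// mulrC; exact: aM.
have cinc : cvgn (series inc).
  apply: normed_cvg; apply: (series_le_cvg _ _ incle) => //.
  - by move=> n; exact: le_trans (normr_ge0 _) (incle n).
  - by apply: is_cvg_geometric_series; rewrite ger0_norm ?invr_ge0//; lra.
have -> : a = (fun n => a 0%N + series inc n).
  apply/funext => n; rewrite /series/= telescope_sumr//.
  by rewrite addrC subrK.
by apply: is_cvgD => //; exact: is_cvg_cst.
Qed.

(** * Completeness of the square-integrable functions on [D] *)

Section riesz_fischer.
Context (d : measure_display) (T : measurableType d) (R : realType)
  (mu : {measure set T -> \bar R}) (D : set T) (mD : measurable D).
Local Notation B := (L2form mu mD).

(** The sum [G] of the squared increments weighted by [4 ^+ k] has integral at most 1, hence is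
    finite almost everywhere; where it is finite, it serves as the bound [M] of
    [cvg_geometric_increments]. *)
Lemma fast_increments_ae (v : nat -> sqfun mu) :
  (forall k, B (v k.+1 - v k) (v k.+1 - v k) <=
      (4 ^+ k)^-1 * (1 / (2 ^ (k + 1))%:R)) ->
  exists E, [/\ measurable E, E `<=` D, mu (D `\` E) = 0%E &
    forall x, E x -> cvgn (fun k => v k x)].
Proof.
move=> vfast.
pose h k x := (4 ^+ k * (v k.+1 x - v k x) ^+ 2)%:E.
have h0 k x : (0 <= h k x)%E by rewrite lee_fin mulr_ge0 ?sqr_ge0// exprn_ge0.
have mh k : measurable_fun D (h k).
  apply/measurable_EFinP; apply: measurable_funM => //; apply: measurable_funX.
  by apply: measurable_funTS; apply: measurable_funB.
pose G x := (\sum_(k <oo) h k x)%E.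
have G0 x : (0 <= G x)%E by apply: nneseries_ge0.
have mG : measurable_fun D G.
  have := @ge0_emeasurable_sum _ _ R D h xpredT (fun k x _ _ => h0 k x)
    (fun k _ => mh k).
  by [].
have iG : (\int[mu]_(x in D) G x < +oo)%E.
  rewrite integral_nneseries//.
  apply: (@le_lt_trans _ _ (\sum_(k <oo) (1 / (2 ^ (k + 1))%:R)%:E)%E); last first.
    by rewrite (cvg_lim _ (@cvg_geometric_eseries_half R 1 0))// ltry.
  apply: lee_nneseries => [k _ _|k _]; first by apply: integral_ge0 => x _; exact: h0.
  under eq_integral do rewrite /h EFinM.
  rewrite ge0_integralZl//.
  - rewrite -(L2form_sqrE mD (v k.+1 - v k)) -EFinM lee_fin.
    by rewrite mulrC -ler_pdivlMr ?exprn_gt0// mulrC.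
  - apply/measurable_EFinP; apply: measurable_funX.
    by apply: measurable_funTS; apply: measurable_funB.
  - by move=> x _; rewrite lee_fin sqr_ge0.
have iGD : mu.-integrable D G.
  apply/integrableP; split => //.
  by under eq_integral do rewrite gee0_abs//.
have [N [mN N0 GN]] := integrable_ae mD iGD.
exists (D `\` N); split => //.
- exact: measurableD.
- by apply: (subset_measure0 (B := N)) => //;
    [exact: measurableD (measurableD _ _)|rewrite setDDr setDv set0U; exact: subIsetr].
- move=> x [Dx Nx].
  have Gx : G x \is a fin_num.
    by apply: contrapT => h'; apply: Nx; apply: GN => /(_ Dx).
  apply: (@cvg_geometric_increments R (fun k => v k x) (fine (G x))) => k.
  rewrite -lee_fin fineK// -/(h k x).
  apply: le_trans (nneseries_lim_ge k.+1 _); last by [].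
  by rewrite big_nat_recr//= leeDr// sume_ge0.
Qed.

Lemma L2form_complete : sip_complete B.
Proof.
move=> u uC.
pose eps k : R := (4 ^+ k)^-1 * (1 / (2 ^ (k + 1))%:R).
have eps0 k : 0 < eps k.
  by rewrite mulr_gt0// ?invr_gt0 ?exprn_gt0// divr_gt0// ltr0n expn_gt0.
have /choice[N NP] k := uC _ (eps0 k).
(* Running sums give a monotone choice of indices that dominates both [N k] and [k]. *)
pose s k := (\sum_(i < k.+1) (N i).+1)%N.
have sN k : (N k <= s k)%N by rewrite /s big_ord_recr/= (leq_trans _ (leq_addl _ _)).
have sk k : (k <= s k)%N.
  rewrite -[leqLHS]muln1 -[X in (X * _)%N]card_ord -sum_nat_const /s big_ord_recr/=.
  by rewrite (leq_trans _ (leq_addr _ _))// leq_sum.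
have sS k : (s k <= s k.+1)%N by rewrite /s [leqRHS]big_ord_recr leq_addr.
have sge k l : (k <= l)%N -> (s k <= s l)%N.
  by move=> kl; exact: (homo_leq (@leqnn) leq_trans sS).
have [E [mE ED DE0 Ecv]] := @fast_increments_ae (u \o s)
  (fun k => ltW (NP k _ _ (leq_trans (sN k) (sS k)) (sN k))).
(* Cutting off at [E] makes the sequence converge at every point, so the limit is measurable on the
   whole space. *)
pose w k := u (s k) \_ E.
pose l x := limn (w^~ x).
have wl x : w^~ x @ \oo --> l x.
  rewrite /l.
  have [Ex|nEx] := pselect (E x).
    have -> : w^~ x = (fun k => u (s k) x).
      by apply/funext => k; rewrite /w patchE mem_set.
    exact: Ecv.
  have w0 : w^~ x = cst 0.
    by apply/funext => k; rewrite /w patchE memNset.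
  rewrite w0 lim_cst//; exact: cvg_cst.
have mw k : measurable_fun setT (w k).
  by apply/(measurable_restrictT _ mE); exact: measurable_funTS.
have ml : measurable_fun setT l by apply: (measurable_fun_cvg mw) => x _.
have lE x : ~ E x -> l x = 0.
  move=> nEx; rewrite /l (_ : w^~ x = cst 0) ?lim_cst//.
  by apply/funext => k; rewrite /w patchE memNset.
(* Fatou's lemma carries an eventual bound on the distance from [u (s k)] to [u n] over to the
   pointwise limit. *)
have fat n e : (exists K, forall k, (K <= k)%N ->
      B (u (s k) - u n) (u (s k) - u n) <= e) ->
    (\int[mu]_(x in D) ((l x - (u n \_ E) x) ^+ 2)%:E <= e%:E)%E.
  move=> [K Ke].
  pose F k x := ((w k x - (u n \_ E) x) ^+ 2)%:E.
  have mF k : measurable_fun D (F k).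
    apply/measurable_EFinP; apply: measurable_funX; apply: measurable_funTS.
    apply: measurable_funB => //.
    by apply/(measurable_restrictT _ mE); exact: measurable_funTS.
  have F0 k x : D x -> (0 <= F k x)%E by move=> _; rewrite lee_fin sqr_ge0.
  rewrite (eq_integral (fun x => limn_einf (F ^~ x))); last first.
    move=> x _; have /cvg_limn_einf_sup[-> _//] : F k x @[k --> \oo] -->
      ((l x - (u n \_ E) x) ^+ 2)%:E.
    apply: cvg_EFin; first exact: nearW.
    have cB : w k x - (u n \_ E) x @[k --> \oo] --> l x - (u n \_ E) x.
      by apply: cvgB; [exact: wl|exact: cvg_cst].
    exact: (cvgM cB cB).
  apply: le_trans (fatou _ mD mF F0) _; apply: limn_einf_le; exists K => k Kk.
  apply: le_trans (_ : (B (u (s k) - u n) (u (s k) - u n))%:E <= _)%E; last first.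
    by rewrite lee_fin Ke.
  rewrite L2form_sqrE; apply: ge0_le_integral => //.
  - exact: F0.
  - apply/measurable_EFinP; apply: measurable_funX; apply: measurable_funTS.
    exact: measurable_funB.
  - move=> x Dx; rewrite lee_fin /w !patchE; case: ifPn => // _.
    by rewrite subrr expr0n/= sqr_ge0.
(* The difference [l \- u (N 0%N) \_ E] vanishes outside [E], hence outside [D], so the bound over
   [D] is a bound over the whole space. *)
have l2 : l \in Lfun mu 2%:E.
  have -> : l = (fun x => (l \- u (N 0%N) \_ E) x + (u (N 0%N) \_ E) x).
    by apply/funext => x; rewrite subrK.
  apply: Lfun2D; last by apply: Lfun2_restrict => //; exact: LfunP.
  apply/Lfun2P; split.
    apply: measurable_funB => //.
    by apply/(measurable_restrictT _ mE); exact: measurable_funTS.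
  apply: le_lt_trans (ltry (eps 0%N)).
  apply: le_trans (fat (N 0%N) (eps 0%N) _); last first.
    by exists 0%N => k _; apply/ltW/NP => //; rewrite (leq_trans (sN _))// sge.
  rewrite [leRHS]integral_mkcond; apply: ge0_le_integral => //.
  - by move=> x _; rewrite lee_fin sqr_ge0.
  - apply/measurable_EFinP; apply: measurable_funX; apply: measurable_funB => //.
    by apply/(measurable_restrictT _ mE); exact: measurable_funTS.
  - apply/(measurable_restrictT _ mD); apply/measurable_EFinP.
    apply: measurable_funX; apply: measurable_funTS; apply: measurable_funB => //.
    by apply/(measurable_restrictT _ mE); exact: measurable_funTS.
  - move=> x _; rewrite [leRHS]patchE; case: ifPn => // xD.
    have nEx : ~ E x by move=> /ED Dx; move: xD; rewrite notin_setE.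
    by rewrite /= lE// patchE memNset//= subrr expr0n.
exists (Lfun_Sub (lee1n 2) l2) => e e0.
have e20 : 0 < e / 2 by rewrite divr_gt0.
have [M MP] := uC _ e20; exists M => n Mn.
apply: (@le_lt_trans _ _ (e / 2)); last lra.
rewrite sip_sqBC -lee_fin L2form_sqrE.
apply: le_trans (fat n (e / 2) _); last first.
  exists M => k Mk; apply/ltW/MP => //; exact: leq_trans (sk k).
(* Within [D], the integrands with and without the cutoff differ only on the null set [D \ E]. *)
rewrite le_eqVlt; apply/orP; left; apply/eqP; apply: ge0_ae_eq_integral => //.
- apply/measurable_EFinP; apply: measurable_funX; apply: measurable_funTS.
  exact: measurable_funB.
- apply/measurable_EFinP; apply: measurable_funX; apply: measurable_funTS.
  apply: measurable_funB => //.
  by apply/(measurable_restrictT _ mE); exact: measurable_funTS.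
- by move=> x _; rewrite lee_fin sqr_ge0.
- by move=> x _; rewrite lee_fin sqr_ge0.
- exists (D `\` E); split => //; first exact: measurableD.
  move=> x /= /not_implyP[Dx h]; split => // Ex; apply: h.
  by rewrite patchE mem_set.
Qed.

End riesz_fischer.

(** * The space L^2(D) for a subset D of the line *)

Lemma Lfun2_indic (d : measure_display) (T : measurableType d) (R : realType)
    (mu : {measure set T -> \bar R}) (A : set T) : measurable A ->
  (mu A < +oo)%E -> (\1_A : T -> R) \in Lfun mu 2%:E.
Proof.
move=> mA Aoo; apply/Lfun2P; split; first exact: measurable_indic.
under eq_integral.
  move=> x _; have -> : (\1_A x : R) ^+ 2 = \1_A x.
    by rewrite indicE; case: (_ \in _); rewrite ?expr1n ?expr0n.
  over.
by rewrite integral_indic// setIT.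
Qed.

Lemma integral_mul_indic (d : measure_display) (T : measurableType d)
    (R : realType) (mu : {measure set T -> \bar R}) (f : T -> R) (A D : set T) :
  (\int[mu]_(x in D) (f x * \1_A x)%:E = \int[mu]_(x in A) ((f \_ D) x)%:E)%E.
Proof.
rewrite integral_mkcond [RHS]integral_mkcond; apply: eq_integral => x _.
rewrite !patchE indicE.
by case: (x \in D); case: (x \in A); rewrite ?mulr1 ?mulr0.
Qed.

Lemma Lfun2_integral_lty (d : measure_display) (T : measurableType d)
    (R : realType) (mu : {measure set T -> \bar R}) (f : T -> R) (A : set T) :
  measurable A -> (mu A < +oo)%E -> f \in Lfun mu 2%:E ->
  (\int[mu]_(x in A) `|f x|%:E < +oo)%E.
Proof.
move=> mA Aoo f2; have /integrableP[_] := Lfun2_integrableM f2 (Lfun2_indic mA Aoo).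
apply: le_lt_trans; rewrite integral_mkcond le_eqVlt; apply/orP; left; apply/eqP.
apply: eq_integral => x _; rewrite patchE indicE.
by case: (_ \in _); rewrite /= ?mulr1 ?mulr0 ?normr0.
Qed.

(** * Dyadic intervals *)

Section dyadic.
Context (R : realType).
Local Notation mu := (@lebesgue_measure R).

Definition dyadic (n : nat) (k : int) : set R :=
  `[k%:~R / 2 ^+ n, (k + 1)%:~R / 2 ^+ n[%classic.

Lemma measurable_dyadic n k : measurable (dyadic n k).
Proof. exact: measurable_itv. Qed.

Lemma dyadic_measure n k : mu (dyadic n k) = ((2^-1) ^+ n)%:E.
Proof.
rewrite lebesgue_measure_itv/= lte_fin ltr_pM2r ?invr_gt0 ?exprn_gt0//.
rewrite ltr_int ltzD1 lexx -EFinB -mulrBl intrD.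
by rewrite addrAC subrr add0r mul1r exprVn.
Qed.

Lemma dyadic_shrinking (x : R) :
  nicely_shrinking x (fun n => dyadic n (Num.floor (x * 2 ^+ n))).
Proof.
split=> [n|]; first exact: measurable_dyadic.
have r0 n : 0 < (2^-1 : R) ^+ n by rewrite exprn_gt0// invr_gt0.
(* The interval containing [x] lies in the ball of radius [2^-1 ^+ n] about [x], whose measure is
   twice that of the interval. *)
exists (2, fun n => PosNum (r0 n)); split => //=.
- have := @cvg_geometric R 1 2^-1; rewrite ger0_norm ?invr_ge0//.
  move=> /(_ ltac:(lra)); apply: cvg_trans; apply: near_eq_cvg.
  by apply: nearW => n; rewrite /geometric/= mul1r.
- move=> n y; rewrite /dyadic /= in_itv/= => /andP[h1 h2].
  have p0 : 0 < 2 ^+ n :> R by rewrite exprn_gt0.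
  have := Num.Theory.floor_itv (x * 2 ^+ n) => /andP[h3 h4].
  move: h1 h2; rewrite ler_pdivrMr// ltr_pdivlMr// => h1 h2.
  rewrite -ball_normE/= exprVn -[ltRHS]mul1r ltr_pdivlMr//.
  rewrite -[X in _ * X](ger0_norm (ltW p0)) -normrM ltr_norml mulrBl.
  move: h2 h4; rewrite intrD => h2 h4; apply/andP; split; lra.
- move=> n; rewrite lebesgue_measure_ball ?(ltW (r0 n))// dyadic_measure -EFinM lee_fin.
  by rewrite mulr_natl.
Qed.

End dyadic.

Section lebesgue_L2.
Context (R : realType) (D : set (measurableTypeR R)) (mD : measurable D).
Local Notation mu := (@lebesgue_measure R).
Local Notation B := (L2form mu mD).

Lemma dyadic_Lfun2 n k : (\1_(@dyadic R n k) : R -> R) \in Lfun mu 2%:E.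
Proof.
have oo : (mu (@dyadic R n k) < +oo)%E by rewrite dyadic_measure ltry.
by apply: (Lfun2_indic _ oo); exact: measurable_dyadic.
Qed.

Lemma locally_integrable_Lfun2 (f : R -> R) : f \in Lfun mu 2%:E ->
  locally_integrable setT f.
Proof.
move=> f2; split; [exact: Lfun_measurable f2|exact: openT|move=> K _ cK].
apply: (Lfun2_integral_lty _ _ f2); first exact: compact_measurable.
exact: compact_finite_measure.
Qed.

(** Lebesgue differentiation along shrinking dyadic intervals recovers the restriction of [u] to [D]
    almost everywhere from its dyadic integrals, all of which are 0. *)
Lemma dyadic_separating (u : sqfun mu) :
  (forall n k, B u (Lfun_Sub (lee1n 2) (dyadic_Lfun2 n k)) = 0) -> B u u = 0.
Proof.
move=> u0; pose f := u \_ D.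
have f2 : f \in Lfun mu 2%:E by apply: Lfun2_restrict => //; exact: LfunP.
have int0 n k : (\int[mu]_(x in @dyadic R n k) (f x)%:E = 0)%E.
  rewrite -integral_mul_indic.
  by have := L2formE mD u (Lfun_Sub (lee1n 2) (dyadic_Lfun2 n k)); rewrite u0 => <-.
apply/L2form_eq0P.
have := lebesgue_differentiation (locally_integrable_Lfun2 f2).
apply: filterS; first exact: (ae_filter_ringOfSetsType mu).
move=> x fx Dx.
have := nice_lebesgue_differentiation (@dyadic_shrinking R)
  (locally_integrable_Lfun2 f2) fx.
under eq_fun do rewrite int0 mule0.
move=> h; have [] : ((f x)%:E = 0)%E.
  by apply: (cvg_unique (@ereal_hausdorff R) h); exact: cvg_cst.
by rewrite /f patchE mem_set.
Qed.

Lemma L2_separating : exists g : nat -> sqfun mu,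
  forall u, (forall q, B u (g q) = 0) -> B u u = 0.
Proof.
(* Numbers that encode no pair are sent to 0, which only adds a trivial condition. *)
exists (fun q => if unpickle q is Some nk
  then Lfun_Sub (lee1n 2) (dyadic_Lfun2 nk.1 nk.2) else 0) => u h.
apply: dyadic_separating => n k; have := h (pickle (n, k)).
by rewrite pickleK.
Qed.

(** The induction also keeps a ball about [t] on which all the functions so far vanish. The next
    function is a normalized indicator of a piece of [D] inside that ball, away from a smaller
    ball. *)
Lemma L2_orthonormal_family (t : R) :
  (forall r : R, 0 < r -> (0 < mu (D `&` ball t r))%E) ->
  forall n, exists h, orthonormal_upto B n h.
Proof.
move=> tD n.
suff [h [r [oh _ _]]] : exists h (r : R), [/\ orthonormal_upto B n h, 0 < r &
    forall i x, (i < n)%N -> ball t r x -> h i x = 0] by exists h.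
elim: n => [|n [h [r [oh r0 hr]]]]; first by exists (fun=> 0), 1.
have mDr : measurable (D `&` ball t r).
  by apply: measurableI => //; exact: measurable_ball.
have Droo : (mu (D `&` ball t r) < +oo)%E.
  apply: le_lt_trans (_ : mu (ball t r) < +oo)%E.
    by apply: le_measure; rewrite ?inE//; exact: measurable_ball.
  by rewrite lebesgue_measure_ball ?ltW// ltry.
have [m muD] : exists m, mu (D `&` ball t r) = m%:E.
  by exists (fine (mu (D `&` ball t r))); rewrite fineK// ge0_fin_numE.
have m0 : 0 < m by rewrite -lte_fin -muD; exact: tD.
(* The smaller ball has measure [2 * r' <= m / 2 < m], so removing it leaves a set of positive
   measure. *)
pose r' := Num.min r (m / 4).
have r'0 : 0 < r' by rewrite /r' lt_min r0 divr_gt0.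
pose A := (D `&` ball t r) `\` ball t r'.
have mA : measurable A by apply: measurableD => //; exact: measurable_ball.
have Aoo : (mu A < +oo)%E.
  by apply: le_lt_trans Droo; apply: le_measure; rewrite ?inE//; exact: subDsetl.
have A0 : (0 < mu A)%E.
  have -> : mu A = (m%:E - mu (D `&` ball t r `&` ball t r'))%E.
    by rewrite -muD; apply: measureD => //; exact: measurable_ball.
  rewrite sube_gt0.
  apply: le_lt_trans (_ : mu (ball t r') < _)%E.
    apply: le_measure; rewrite ?inE.
    - by apply: measurableI => //; exact: measurable_ball.
    - exact: measurable_ball.
    - exact: subIsetr.
  rewrite lebesgue_measure_ball ?ltW// lte_fin -mulr_natl.
  have : r' <= m / 4 by rewrite /r' ge_min lexx orbT.
  lra.
pose a := Lfun_Sub (lee1n 2) (@Lfun2_indic _ _ R mu A mA Aoo).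
have Ba : (B a a)%:E = mu A.
  rewrite L2form_sqrE (eq_integral (fun x => (\1_A x)%:E)).
    by rewrite integral_indic// setIidl// => x [[]].
  by move=> x _; rewrite /= indicE; case: (_ \in _); rewrite ?expr1n ?expr0n.
have Ba0 : 0 < B a a by rewrite -lte_fin Ba.
pose c := (Num.sqrt (B a a))^-1.
have ha i : (i < n)%N -> B (h i) a = 0.
  move=> lin; rewrite /= (@eq_Rintegral _ _ _ _ _ (cst 0)).
    by rewrite Rintegral_cst// mul0r.
  move=> x _; rewrite indicE; have [xA|] := boolP (x \in A); last by rewrite mulr0.
  by move: xA; rewrite inE => -[[_ xr] _]; rewrite hr// mul0r.
exists (fun i => if (i < n)%N then h i else c *: a), r'; split => //.
- move=> i j; rewrite !ltnS (leq_eqVlt i) (leq_eqVlt j).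
  move=> /predU1P[->|lin] /predU1P[->|ljn].
  + rewrite ltnn eqxx sipZl sipZr mulrA -expr2 exprVn sqr_sqrtr ?sip_ge0//.
    by rewrite mulVf// gt_eqF.
  + by rewrite ltnn ljn sipZl sipC ha// mulr0 gtn_eqF.
  + by rewrite ltnn lin sipZr ha// mulr0 ltn_eqF.
  + by rewrite lin ljn oh.
- move=> i x _ xr'; case: ifPn => [lin|_].
    by apply: hr => //; apply: le_ball xr'; rewrite /r' ge_min lexx.
  rewrite sqfunZ/= indicE memNset ?mulr0//; by case.
Qed.

End lebesgue_L2.

(** * Hilbert-Schmidt integral operators *)

Section parametric_integral.
Context (d1 d2 : measure_display) (T1 : measurableType d1)
  (T2 : measurableType d2) (R : realType)
  (m1 : {sigma_finite_measure set T1 -> \bar R})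
  (m2 : {sigma_finite_measure set T2 -> \bar R}).

(** No integrability is assumed, so Tonelli's measurability is applied to the positive and negative
    parts separately. *)
Lemma measurable_Rintegral1 (f : T1 * T2 -> R) : measurable_fun setT f ->
  measurable_fun setT (fun x => \int[m2]_y f (x, y)).
Proof.
move=> mf; have mE : measurable_fun setT (EFin \o f) by exact/measurable_EFinP.
apply: measurableT_comp => //.
under eq_fun do rewrite integralE.
apply: emeasurable_funB.
- rewrite [X in measurable_fun _ X](_ : _ = fubini_F m2 ((EFin \o f)^\+)%E).
    apply: measurable_fun_fubini_tonelli_F; first exact: measurable_funepos.
    by move=> x; exact: funepos_ge0.
  by apply/funext => x; apply: eq_integral => y _; rewrite !funeposE.
- rewrite [X in measurable_fun _ X](_ : _ = fubini_F m2 ((EFin \o f)^\-)%E).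
    apply: measurable_fun_fubini_tonelli_F; first exact: measurable_funeneg.
    by move=> x; exact: funeneg_ge0.
  by apply/funext => x; apply: eq_integral => y _; rewrite !funenegE.
Qed.

Lemma Lfun2_swap (Y : T1 * T2 -> R) : Y \in Lfun (m1 \x m2)%E 2%:E ->
  (fun yx => Y (yx.2, yx.1)) \in Lfun (m2 \x m1)%E 2%:E.
Proof.
move=> /Lfun2P[mY Yoo]; apply/Lfun2P; split.
  by apply: (measurableT_comp mY); exact: measurable_fun_pair.
have mY2 : measurable_fun setT (fun z => (Y z ^+ 2)%:E).
  by apply/measurable_EFinP; exact: measurable_funX.
move: Yoo; rewrite fubini_tonelli2//; last first.
  by move=> x; rewrite lee_fin sqr_ge0.
rewrite fubini_tonelli1//=.
- apply/measurable_EFinP; apply: measurable_funX.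
  by apply: (measurableT_comp mY); exact: measurable_fun_pair.
- by move=> x; rewrite lee_fin sqr_ge0.
Qed.

Lemma Lfun2_section (Y : T1 * T2 -> R) : Y \in Lfun (m1 \x m2)%E 2%:E ->
  {ae m1, forall x, (fun y => Y (x, y)) \in Lfun m2 2%:E}.
Proof.
move=> Y2; have /Lfun2P[mY _] := Y2.
have := ae_integrable1 (Lfun2_integrable_sqr Y2); apply: filterS => x.
move=> /integrableP[_ ioo]; apply/Lfun2P; split.
  by apply: measurableT_comp => //; exact: measurable_pair1.
apply: le_lt_trans ioo; rewrite le_eqVlt; apply/orP; left; apply/eqP.
by apply: eq_integral => y _; rewrite /= ger0_norm ?sqr_ge0.
Qed.

End parametric_integral.

Section hilbert_schmidt.
Context (d1 d2 : measure_display) (T1 : measurableType d1)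
  (T2 : measurableType d2) (R : realType)
  (m1 : {sigma_finite_measure set T1 -> \bar R})
  (m2 : {sigma_finite_measure set T2 -> \bar R}).
Context (Y : T1 * T2 -> R) (Y2 : Y \in Lfun (m1 \x m2)%E 2%:E).

Definition hs_op (u : T2 -> R) (x : T1) : R := \int[m2]_y (Y (x, y) * u y).

Let mY : measurable_fun setT Y. Proof. exact: Lfun_measurable Y2. Qed.

Let mY2 : measurable_fun setT (fun z => (Y z ^+ 2)%:E).
Proof. by apply/measurable_EFinP; exact: measurable_funX. Qed.

Let Y20 z : (0 <= (Y z ^+ 2)%:E)%E. Proof. by rewrite lee_fin sqr_ge0. Qed.

Let secY x := (\int[m2]_y (Y (x, y) ^+ 2)%:E)%E.

Let msecY : measurable_fun setT secY.
Proof. exact: (@measurable_fun_fubini_tonelli_F _ _ _ _ _ m2 _ mY2 Y20). Qed.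

Let secY0 x : (0 <= secY x)%E. Proof. by apply: integral_ge0. Qed.

Lemma integral_section_sqr :
  (\int[m1]_x secY x = \int[m1 \x m2]_z (Y z ^+ 2)%:E)%E.
Proof. by rewrite fubini_tonelli1. Qed.

Lemma measurable_hs_op u : measurable_fun setT u ->
  measurable_fun setT (hs_op u).
Proof.
move=> mu; apply: (@measurable_Rintegral1 _ _ _ _ _ _ (fun z => Y z * u z.2)).
by apply: measurable_funM => //; exact: measurableT_comp.
Qed.

(** Cauchy-Schwarz on almost every section bounds the squared value by [c * secY x], whose integral
    is finite by Tonelli. *)
Lemma hs_op_Lfun2 u : u \in Lfun m2 2%:E -> hs_op u \in Lfun m1 2%:E.
Proof.
move=> u2; apply/Lfun2P; split.
  by apply: measurable_hs_op; exact: Lfun_measurable u2.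
pose us := Lfun_Sub (lee1n 2) u2; pose c := L2form m2 measurableT us us.
apply: (@le_lt_trans _ _ (\int[m1]_x (c%:E * secY x))%E).
  apply: ae_ge0_le_integral => //.
  - by move=> x _; rewrite lee_fin sqr_ge0.
  - apply/measurable_EFinP; apply: measurable_funX; apply: measurable_hs_op.
    exact: Lfun_measurable u2.
  - by move=> x _; rewrite mule_ge0// lee_fin sip_ge0.
  - exact: measurable_funeM.
  - have := Lfun2_section Y2; apply: filterS => x xY _.
    pose xs := Lfun_Sub (lee1n 2) xY.
    have -> : (c%:E * secY x = (c * L2form m2 measurableT xs xs)%:E)%E.
      by rewrite EFinM (L2form_sqrE measurableT xs).
    by rewrite lee_fin mulrC; exact: (sip_CS (L2form m2 measurableT) xs us).
rewrite ge0_integralZl//; last by rewrite lee_fin sip_ge0.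
rewrite lte_mul_pinfty ?lee_fin ?sip_ge0// integral_section_sqr.
by have /Lfun2P[] := Y2.
Qed.

(** The tensor product of [g] and [u] is square integrable by Tonelli; this provides the
    integrability that Fubini needs in [hs_adjE]. *)
Lemma tensor_integrable (g : T1 -> R) (u : T2 -> R) :
  g \in Lfun m1 2%:E -> u \in Lfun m2 2%:E ->
  (m1 \x m2)%E.-integrable setT (fun z => (Y z * (g z.1 * u z.2))%:E).
Proof.
move=> /[dup] g2 /Lfun2P[mg goo] /[dup] u2 /Lfun2P[mu uoo].
apply: Lfun2_integrableM => //; apply/Lfun2P.
have m : measurable_fun setT (fun z : T1 * T2 => g z.1 * u z.2).
  by apply: measurable_funM; exact: measurableT_comp.
split => //; rewrite fubini_tonelli1/fubini_F; last first.
- by move=> z; rewrite lee_fin sqr_ge0.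
- by apply/measurable_EFinP; exact: measurable_funX.
pose c := (\int[m2]_y (u y ^+ 2)%:E)%E.
have c0 : (0 <= c)%E by apply: integral_ge0 => y _; rewrite lee_fin sqr_ge0.
have mg2 : measurable_fun setT (fun x => (g x ^+ 2)%:E).
  by apply/measurable_EFinP; exact: measurable_funX.
have mu2 : measurable_fun setT (fun x => (u x ^+ 2)%:E).
  by apply/measurable_EFinP; exact: measurable_funX.
have E x : (\int[m2]_y ((g x * u y) ^+ 2)%:E = c * (g x ^+ 2)%:E)%E.
  under eq_integral do rewrite exprMn EFinM.
  by rewrite ge0_integralZl ?lee_fin ?sqr_ge0 1?muleC// => y _; rewrite lee_fin sqr_ge0.
rewrite (eq_integral (fun x => c * (g x ^+ 2)%:E)%E); last by move=> x _; exact: E.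
rewrite ge0_integralZl//; last by move=> y _; rewrite lee_fin sqr_ge0.
by rewrite lte_mul_pinfty// ge0_fin_numE.
Qed.

End hilbert_schmidt.

Section adjoint.
Context (d1 d2 : measure_display) (T1 : measurableType d1)
  (T2 : measurableType d2) (R : realType)
  (m1 : {sigma_finite_measure set T1 -> \bar R})
  (m2 : {sigma_finite_measure set T2 -> \bar R}).
Context (Y : T1 * T2 -> R) (Y2 : Y \in Lfun (m1 \x m2)%E 2%:E).

Definition hs_adj (g : T1 -> R) (y : T2) : R := \int[m1]_x (Y (x, y) * g x).

Lemma hs_adj_Lfun2 g : g \in Lfun m1 2%:E -> hs_adj g \in Lfun m2 2%:E.
Proof. exact: (hs_op_Lfun2 (Lfun2_swap Y2)). Qed.

Lemma hs_adjE (g : T1 -> R) (u : T2 -> R) :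
  g \in Lfun m1 2%:E -> u \in Lfun m2 2%:E ->
  \int[m2]_y (hs_adj g y * u y) = \int[m1]_x (g x * hs_op m2 Y u x).
Proof.
move=> g2 u2; have i := tensor_integrable Y2 g2 u2.
have /integral21_prod_meas1 h := i; rewrite -(integral12_prod_meas1 i) in h.
rewrite /Rintegral; congr fine.
(* Moving [u y] into the inner integral is justified only for almost every [y], where the section of
   [Y] is square integrable. *)
transitivity (\int[m2]_y fubini_G m1 (fun z => (Y z * (g z.1 * u z.2))%:E) y)%E.
  apply: ae_eq_integral => //.
  - apply/measurable_EFinP; apply: measurable_funM; last exact: Lfun_measurable u2.
    by apply: Lfun_measurable (hs_adj_Lfun2 g2).
  - exact: measurable_fubini_G i.
  have := ae_integrable2 i; have := Lfun2_section (Lfun2_swap Y2).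
  apply: filterS2 => y yY iy _.
  have ig : m1.-integrable setT (fun x => (Y (x, y) * g x)%:E).
    exact: (Lfun2_integrableM yY g2).
  rewrite /hs_adj /fubini_G -RintegralZr//= /Rintegral fineK.
    by apply: eq_integral => x _; rewrite mulrA.
  apply: integrable_fin_num => //; move: iy; apply: eq_integrable => // x _.
  by rewrite /= mulrA.
rewrite h; apply: ae_eq_integral => //.
- exact: measurable_fubini_F i.
- apply/measurable_EFinP; apply: measurable_funM; first exact: Lfun_measurable g2.
  by apply: Lfun_measurable (hs_op_Lfun2 Y2 u2).
have := ae_integrable1 i; have := Lfun2_section Y2.
apply: filterS2 => x xY ix _.
have iu : m2.-integrable setT (fun y => (Y (x, y) * u y)%:E).
  exact: (Lfun2_integrableM xY u2).
rewrite /hs_op /fubini_F -RintegralZl//= /Rintegral fineK.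
  by apply: eq_integral => y _; rewrite mulrCA.
apply: integrable_fin_num => //; move: ix; apply: eq_integrable => // y _.
by rewrite /= mulrCA.
Qed.

End adjoint.

(** * Projection on the vectors of a selected set of indices *)

Section filtered_projection.
Context (R : realType) (V : lmodType R) (B : semi_inner V) (p : pred nat)
  (f : nat -> V).
Hypothesis fo : forall i j, p i -> p j -> B (f i) (f j) = (i == j)%:R.

Definition proj_on n u := \sum_(i < n | p i) B u (f i) *: f i.

Lemma sip_sq_residual_on n u :
  B (u - proj_on n u) (u - proj_on n u) = B u u - \sum_(i < n | p i) B u (f i) ^+ 2.
Proof.
have h1 : B u (proj_on n u) = \sum_(i < n | p i) B u (f i) ^+ 2.
  by rewrite sip_sumr; apply: eq_bigr => i _; rewrite sipZr expr2.
have h2 : B (proj_on n u) (proj_on n u) = \sum_(i < n | p i) B u (f i) ^+ 2.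
  rewrite sip_sumr; apply: eq_bigr => i pi; rewrite sipZr expr2; congr (_ * _).
  rewrite sip_suml (bigD1 i)//= sipZl fo// eqxx mulr1 big1 ?addr0// => j /andP[pj ji].
  by rewrite sipZl fo// val_eqE (negPf ji) mulr0.
by rewrite sip_sqB h1 h2; ring.
Qed.

Lemma bessel_on n u : \sum_(i < n | p i) B u (f i) ^+ 2 <= B u u.
Proof. by rewrite -subr_ge0 -sip_sq_residual_on sip_ge0. Qed.

Lemma proj_onB n u v : proj_on n (u - v) = proj_on n u - proj_on n v.
Proof.
by rewrite /proj_on -sumrB; apply: eq_bigr => i _; rewrite sipBl scalerBl.
Qed.

(** The residual of [u] is that of [u - v] plus that of [v], and taking residuals does not increase
    the norm. *)
Lemma residual_on_le n u v : B (u - proj_on n u) (u - proj_on n u) <=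
  2 * B (u - v) (u - v) + 2 * B (v - proj_on n v) (v - proj_on n v).
Proof.
have -> : u - proj_on n u = (u - v) - proj_on n (u - v) + (v - proj_on n v).
  rewrite proj_onB opprB addrACA subrK.
  by congr (_ + _); rewrite addrAC subrr add0r.
apply: le_trans (sip_sqD_le _ _ _) _; rewrite lerD2r ler_pM2l//.
rewrite sip_sq_residual_on lerBlDr lerDl sumr_ge0// => i _; exact: sqr_ge0.
Qed.

End filtered_projection.

Lemma parseval (R : realType) (V : lmodType R) (B : semi_inner V) (e : nat -> V) u :
  (forall i j, B (e i) (e j) = (i == j)%:R) ->
  sip_cvg B (fun n => \sum_(i < n) B u (e i) *: e i) u ->
  (\sum_(i <oo) (B u (e i) ^+ 2)%:E = (B u u)%:E)%E.
Proof.
move=> eo ecv; apply: cvg_lim => //.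
rewrite [X in X @ _ --> _](_ : _ =
  EFin \o (fun n => \sum_(i < n) B u (e i) ^+ 2)); last first.
  by apply/funext => n; rewrite /= big_mkord sumEFin.
apply: cvg_EFin; first exact: nearW.
apply/cvgrPdist_lt => eps e0; have [N hN] := ecv _ e0.
exists N => // n /hN; rewrite sip_sqBC sip_sq_residual; last by move=> i j _ _; exact: eo.
move=> h; rewrite /= ger0_norm// subr_ge0.
by apply: bessel => i j _ _; exact: eo.
Qed.

(** The difference [f \- g] is nonnegative almost everywhere and, the common integral being finite,
    has integral 0. *)
Lemma ge0_le_integral_eq_ae (d : measure_display) (T : measurableType d)
    (R : realType) (mu : {measure set T -> \bar R}) (D : set T)
    (f g : T -> \bar R) : measurable D ->
  measurable_fun D f -> measurable_fun D g ->
  (forall x, D x -> (0 <= f x)%E) -> (forall x, D x -> (0 <= g x)%E) ->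
  {ae mu, forall x, D x -> (g x <= f x)%E} ->
  (\int[mu]_(x in D) f x = \int[mu]_(x in D) g x)%E ->
  (\int[mu]_(x in D) f x < +oo)%E ->
  {ae mu, forall x, D x -> f x = g x}.
Proof.
move=> mD mf mg f0 g0 gf fg foo.
have fi : mu.-integrable D f.
  apply/integrableP; split => //; apply: le_lt_trans foo.
  by apply: ge0_le_integral => //; [exact: measurableT_comp|move=> x /f0/gee0_abs->].
have gi : mu.-integrable D g.
  apply/integrableP; split => //; rewrite fg in foo; apply: le_lt_trans foo.
  by apply: ge0_le_integral => //; [exact: measurableT_comp|move=> x /g0/gee0_abs->].
have ffin := integrable_ae mD fi; have gfin := integrable_ae mD gi.
have mB : measurable_fun D (f \- g)%E by exact: emeasurable_funB.
have : (\int[mu]_(x in D) `|(f \- g) x| = 0)%E.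
  rewrite -[RHS](_ : (\int[mu]_(x in D) (f \- g) x = 0)%E).
    apply: ae_eq_integral => //; first exact: measurableT_comp.
    move: gf ffin gfin; apply: filterS3 => x gfx fx gx Dx.
    by rewrite gee0_abs// sube_ge0 ?gfx ?gx ?fx.
  rewrite integralB// fg subee//; exact: integrable_fin_num.
move=> /(ae_eq_integral_abs _ mD mB); move: ffin gfin.
apply: filterS3 => x fx gx fgx Dx; have /eqP := fgx Dx.
by rewrite /= sube_eq ?gx ?fx ?add0e// => /eqP.
Qed.

(** * The operator with kernel [Y], its adjoint and their composite *)

Section hs_operators.
Context (d1 d2 : measure_display) (T1 : measurableType d1)
  (T2 : measurableType d2) (R : realType)
  (m1 : {sigma_finite_measure set T1 -> \bar R})
  (m2 : {sigma_finite_measure set T2 -> \bar R}).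
Context (Y : T1 * T2 -> R) (Y2 : Y \in Lfun (m1 \x m2)%E 2%:E).
Context (D : set T2) (mD : measurable D).
Hypothesis Y0 : forall x y, ~ D y -> Y (x, y) = 0.

Local Notation B1 := (L2form m1 measurableT).
Local Notation B2 := (L2form m2 mD).

Definition hsA (u : sqfun m2) : sqfun m1 :=
  Lfun_Sub (lee1n 2) (hs_op_Lfun2 Y2 (LfunP u)).

Definition hsB (g : sqfun m1) : sqfun m2 :=
  Lfun_Sub (lee1n 2) (hs_adj_Lfun2 Y2 (LfunP g)).

(** This is [A^* A]; for the kernel of a process it turns out to be the autocorrelation operator. *)
Definition hsK (u : sqfun m2) : sqfun m2 := hsB (hsA u).

Lemma hsB_adj g u : B2 (hsB g) u = B1 g (hsA u).
Proof.
rewrite /= -(hs_adjE Y2 (LfunP g) (LfunP u)) Rintegral_mkcond.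
apply: eq_Rintegral => y _; rewrite patchE; case: ifPn => // yD.
rewrite /hs_adj (@eq_Rintegral _ _ _ _ _ (cst 0)) ?Rintegral_cst ?mul0r// => x _.
by rewrite Y0 ?mul0r//; move: yD; rewrite notin_setE.
Qed.

Lemma hsK_sym u v : B2 (hsK u) v = B2 u (hsK v).
Proof. by rewrite hsB_adj [RHS]sipC hsB_adj sipC. Qed.

Lemma hsK_pos u : 0 <= B2 (hsK u) u.
Proof. by rewrite hsB_adj sip_ge0. Qed.

Definition hs_energy : \bar R := (\int[m1 \x m2]_z (Y z ^+ 2)%:E)%E.

Lemma hs_energy_lty : (hs_energy < +oo)%E.
Proof. by have /Lfun2P[] := Y2. Qed.

Let mY2 : measurable_fun setT (fun z => (Y z ^+ 2)%:E).
Proof.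
by have /Lfun2P[mY _] := Y2; apply/measurable_EFinP; exact: measurable_funX.
Qed.

Lemma hs_section_form x (xY : (fun y => Y (x, y)) \in Lfun m2 2%:E) u :
  B2 (Lfun_Sub (lee1n 2) xY) u = hsA u x.
Proof.
rewrite /= /hs_op Rintegral_mkcond; apply: eq_Rintegral => y _.
by rewrite patchE; case: ifPn => // yD; rewrite Y0 ?mul0r//; move: yD; rewrite notin_setE.
Qed.

Lemma hs_section_sqr x (xY : (fun y => Y (x, y)) \in Lfun m2 2%:E) :
  (B2 (Lfun_Sub (lee1n 2) xY) (Lfun_Sub (lee1n 2) xY))%:E
    = (\int[m2]_y (Y (x, y) ^+ 2)%:E)%E.
Proof.
rewrite L2form_sqrE integral_mkcond; apply: eq_integral => y _.
rewrite patchE; case: ifPn => // yD; rewrite Y0 ?expr0n//.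
by move: yD; rewrite notin_setE.
Qed.

Lemma hsA_sqr_measurable u : measurable_fun setT (fun x => (hsA u x ^+ 2)%:E).
Proof. by apply/measurable_EFinP; apply: measurable_funX. Qed.

(** The sum equals the integral over [x] of the squared coefficients of the section of [Y] at [x];
    Bessel bounds them on almost every section. *)
Lemma hsK_trace n f : orthonormal_upto B2 n f ->
  \sum_(i < n) B2 (hsK (f i)) (f i) <= fine hs_energy.
Proof.
move=> fo; rewrite -lee_fin fineK; last first.
  rewrite ge0_fin_numE ?hs_energy_lty// integral_ge0// => z _.
  by rewrite lee_fin sqr_ge0.
rewrite -sumEFin; under eq_bigr do rewrite hsB_adj L2form_sqrE.
rewrite -ge0_integral_sum//; last 2 first.
- by move=> i; exact: hsA_sqr_measurable.
- by move=> i x _; rewrite lee_fin sqr_ge0.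
rewrite /hs_energy fubini_tonelli1//; last by move=> z; rewrite lee_fin sqr_ge0.
apply: ae_ge0_le_integral => //.
- by move=> x _; apply: sume_ge0 => i _; rewrite lee_fin sqr_ge0.
- by apply: emeasurable_sum => i; exact: hsA_sqr_measurable.
- by move=> x _; apply: integral_ge0 => y _; rewrite lee_fin sqr_ge0.
- apply: measurable_fun_fubini_tonelli_F => // z; by rewrite lee_fin sqr_ge0.
have := Lfun2_section Y2; apply: filterS => x xY _.
rewrite /fubini_F -(hs_section_sqr xY) sumEFin lee_fin.
under eq_bigr do rewrite -(hs_section_form xY).
exact: bessel.
Qed.

(** The computation of [hsK_trace] with Parseval in place of Bessel. *)
Lemma hs_trace_energy (e : nat -> sqfun m2) :
  (forall i j, B2 (e i) (e j) = (i == j)%:R) ->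
  (forall u, sip_cvg B2 (fun n => \sum_(i < n) B2 u (e i) *: e i) u) ->
  (\sum_(i <oo) (B2 (hsK (e i)) (e i))%:E = hs_energy)%E.
Proof.
move=> eo ecv.
rewrite (eq_eseriesr (g := fun i => \int[m1]_x (hsA (e i) x ^+ 2)%:E)%E); last first.
  by move=> i _; rewrite hsB_adj L2form_sqrE.
rewrite -integral_nneseries//; last 2 first.
- by move=> i; exact: hsA_sqr_measurable.
- by move=> i x _; rewrite lee_fin sqr_ge0.
rewrite /hs_energy fubini_tonelli1//; last by move=> z; rewrite lee_fin sqr_ge0.
apply: ae_eq_integral => //.
- exact: (@ge0_emeasurable_sum _ _ R setT (fun i x => (hsA (e i) x ^+ 2)%:E) xpredT
    (fun k x _ _ => sqr_ge0 _) (fun k _ => hsA_sqr_measurable (e k))).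
- apply: measurable_fun_fubini_tonelli_F => // z; by rewrite lee_fin sqr_ge0.
have := Lfun2_section Y2; apply: filterS => x xY _.
rewrite /fubini_F -(hs_section_sqr xY) -(parseval eo (ecv _)).
by apply: eq_eseriesr => i _; rewrite (hs_section_form xY).
Qed.

(** The equality holds at every point, since each value is an integral that ignores null sets and
    the kernel vanishes outside [D]. *)
Lemma hsA_null u v : B2 (u - v) (u - v) = 0 -> hsA u = hsA v.
Proof.
move=> /L2form_eq0P uv; apply/LfuneqP => x; rewrite /= /hs_op /Rintegral.
have /Lfun2P[mY _] := Y2.
have mYx : measurable_fun setT (fun y => Y (x, y)).
  by apply: measurableT_comp => //; exact: measurable_pair1.
congr fine; apply: ae_eq_integral => //.
- by apply/measurable_EFinP; apply: measurable_funM.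
- by apply/measurable_EFinP; apply: measurable_funM.
move: uv; apply: filterS => y h _; have [Dy|nDy] := pselect (D y).
  by have /eqP := h Dy; rewrite sqfunB subr_eq0 => /eqP ->.
by rewrite Y0// !mul0r.
Qed.

Lemma hs_eigenbasis (g : nat -> sqfun m2) :
  (forall u, (forall q, B2 u (g q) = 0) -> B2 u u = 0) ->
  (forall n, exists h, orthonormal_upto B2 n h) ->
  exists (e : nat -> sqfun m2) (lambda : nat -> R),
    [/\ forall i j, B2 (e i) (e j) = (i == j)%:R,
        forall u, sip_cvg B2 (fun n => \sum_(i < n) B2 u (e i) *: e i) u,
        forall i, 0 <= lambda i,
        forall i, eigenvector B2 hsK (e i) (lambda i) &
        forall i y, 0 < lambda i -> hsK (e i) y = lambda i * e i y].
Proof.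
move=> gsep hinf.
have [e [lam [eo ecv lam0 elam]]] :=
  eigenbasis hsK_sym hsK_pos hsK_trace (@L2form_complete _ _ _ _ _ mD) gsep hinf.
(* This representative satisfies the eigenvalue equation at every point, not
   only almost everywhere. *)
pose e' i := if 0 < lam i then (lam i)^-1 *: hsK (e i) else e i.
(* The new vectors are at distance 0 from the old ones, so every property stated through [B2]
   carries over. *)
have ee' i v : B2 (e' i) v = B2 (e i) v.
  rewrite /e'; case: ifPn => // li.
  by rewrite sipZl elam mulrA mulVf ?mul1r// gt_eqF.
have e'0 i : B2 (e i - e' i) (e i - e' i) = 0 by rewrite sipBl !ee' subrr.
have Ke' i : hsK (e' i) = hsK (e i) by rewrite /hsK (hsA_null (e'0 i)).
exists e', lam; split.
- by move=> i j; rewrite ee' sipC ee' sipC eo.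
- move=> u eps eps0; have [N hN] := ecv u _ eps0; exists N => n /hN.
  set w := \sum_(i < n) _ => wu.
  set w' := \sum_(i < n) _.
  suff ww' v : B2 w' v = B2 w v.
    by rewrite sip_sqB !ww' (sipC B2 w w') ww' -sip_sqB.
  rewrite !sip_suml; apply: eq_bigr => i _.
  by rewrite !sipZl ee' (sipC _ u) ee' (sipC _ u).
- exact: lam0.
- by move=> i v; rewrite Ke' ee' elam.
- by move=> i y li; rewrite Ke' /e' li sqfunZ mulrA divff ?mul1r// gt_eqF.
Qed.

End hs_operators.

(** * Expansion of the sections of the kernel *)

Section expansion.
Context (d1 d2 : measure_display) (T1 : measurableType d1)
  (T2 : measurableType d2) (R : realType)
  (m1 : {sigma_finite_measure set T1 -> \bar R})
  (m2 : {sigma_finite_measure set T2 -> \bar R}).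
Context (Y : T1 * T2 -> R) (Y2 : Y \in Lfun (m1 \x m2)%E 2%:E).
Context (D : set T2) (mD : measurable D).
Hypothesis Y0 : forall x y, ~ D y -> Y (x, y) = 0.

Local Notation B1 := (L2form m1 measurableT).
Local Notation B2 := (L2form m2 mD).

Context (e : nat -> sqfun m2) (lam : nat -> R).
Hypothesis eo : forall i j, B2 (e i) (e j) = (i == j)%:R.
Hypothesis ecv : forall u, sip_cvg B2 (fun n => \sum_(i < n) B2 u (e i) *: e i) u.
Hypothesis lam0 : forall i, 0 <= lam i.
Hypothesis elam : forall i, eigenvector B2 (hsK Y2) (e i) (lam i).
Hypothesis epw : forall i y, 0 < lam i -> hsK Y2 (e i) y = lam i * e i y.

(** For [lam i = 0] the inverse is 0 by convention and the vector is 0. *)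
Definition kl_vec i : sqfun m1 := (Num.sqrt (lam i))^-1 *: hsA Y2 (e i).

Let pos i := 0 < lam i.

Lemma hsA_eigen i j : B1 (hsA Y2 (e i)) (hsA Y2 (e j)) = lam i * (i == j)%:R.
Proof. by rewrite -(hsB_adj Y2 mD Y0) elam eo. Qed.

Lemma kl_vec_orthonormal i j : 0 < lam i -> 0 < lam j ->
  B1 (kl_vec i) (kl_vec j) = (i == j)%:R.
Proof.
move=> li lj; rewrite /kl_vec sipZl sipZr hsA_eigen.
case: eqP => [<-|_]; last by rewrite !mulr0.
by rewrite mulr1 mulrA -invfM -expr2 sqr_sqrtr// mulVf// gt_eqF.
Qed.

Section one_section.
Context (y : T2) (yY : (fun x => Y (x, y)) \in Lfun m1 2%:E).
Let s := Lfun_Sub (lee1n 2) yY.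

(** Pairing the section at [y] with [hsA Y2 (e i)] is by definition evaluating [hsK Y2 (e i)] at
    [y]; the pointwise eigenvalue equation [epw] then applies at this very [y]. *)
Lemma section_coef i : 0 < lam i -> B1 s (kl_vec i) = Num.sqrt (lam i) * e i y.
Proof.
move=> li; rewrite /kl_vec sipZr.
have -> : B1 s (hsA Y2 (e i)) = hsK Y2 (e i) y by [].
rewrite epw// -{2}[lam i]sqr_sqrtr// expr2 !mulrA mulVf ?mul1r//.
by rewrite gt_eqF// sqrtr_gt0.
Qed.

Lemma section_coef_sum n :
  \sum_(i < n | pos i) B1 s (kl_vec i) ^+ 2 = \sum_(i < n) lam i * e i y ^+ 2.
Proof.
rewrite big_mkcond; apply: eq_bigr => i _; rewrite /pos; case: ifPn => [li|].
  by rewrite section_coef// exprMn sqr_sqrtr.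
rewrite -leNgt => li; have -> : lam i = 0 by apply/eqP; rewrite eq_le li lam0.
by rewrite mul0r.
Qed.

Lemma section_energyE :
  (B1 s s)%:E = (\int[m1]_x (Y (x, y) ^+ 2)%:E)%E.
Proof. exact: (L2form_sqrE measurableT s). Qed.

Lemma section_bessel n : \sum_(i < n) lam i * e i y ^+ 2 <= B1 s s.
Proof.
rewrite -section_coef_sum; apply: bessel_on => i j.
exact: kl_vec_orthonormal.
Qed.

(** The squared residual is the energy of the section minus a partial sum of the series. *)
Lemma section_expansion :
  (\int[m1]_x (Y (x, y) ^+ 2)%:E = \sum_(i <oo) (lam i * e i y ^+ 2)%:E)%E ->
  sip_cvg B1 (fun n => proj_on B1 pos kl_vec n s) s.
Proof.
rewrite -section_energyE => E.
have : (\sum_(0 <= i < n) (lam i * e i y ^+ 2)%:E)%E @[n --> \oo] --> (B1 s s)%:E.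
  rewrite E; apply: is_cvg_nneseries => i _ _.
  by rewrite lee_fin mulr_ge0 ?sqr_ge0.
under eq_fun do rewrite sumEFin big_mkord.
move=> /fine_cvgP[_ /cvgrPdist_lt h] eps e0; have [N _ hN] := h _ e0.
exists N => n /hN hn; rewrite sip_sqBC sip_sq_residual_on; last exact: kl_vec_orthonormal.
by rewrite section_coef_sum; apply: le_lt_trans hn; exact: ler_norm.
Qed.

End one_section.

(** Bessel bounds the series by the energy of almost every section, and both integrate over [D] to
    [hs_energy]: the left side by Tonelli, the series because its integral is the trace. *)
Lemma ae_section_energy : {ae m2, forall y, D y ->
  (\int[m1]_x (Y (x, y) ^+ 2)%:E = \sum_(i <oo) (lam i * e i y ^+ 2)%:E)%E}.
Proof.
have mY2 : measurable_fun setT (fun z => (Y z ^+ 2)%:E).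
  by have /Lfun2P[mY _] := Y2; apply/measurable_EFinP; exact: measurable_funX.
have Y20 z : (0 <= (Y z ^+ 2)%:E)%E by rewrite lee_fin sqr_ge0.
have g0 i y : (0 <= (lam i * e i y ^+ 2)%:E)%E.
  by rewrite lee_fin mulr_ge0 ?sqr_ge0.
have mg i : measurable_fun D (fun y => (lam i * e i y ^+ 2)%:E).
  apply/measurable_EFinP; apply: measurable_funM => //.
  by apply: measurable_funX; exact: measurable_funTS.
have fE : (\int[m2]_(y in D) \int[m1]_x (Y (x, y) ^+ 2)%:E = hs_energy m1 m2 Y)%E.
  rewrite /hs_energy fubini_tonelli2// integral_mkcond; apply: eq_integral => y _.
  rewrite patchE; case: ifPn => //; rewrite notin_setE => yD.
  by rewrite /fubini_G integral0_eq// => x _; rewrite Y0// expr0n.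
apply: ge0_le_integral_eq_ae => //.
- apply: measurable_funTS.
  exact: (@measurable_fun_fubini_tonelli_G _ _ _ _ _ m1 _ mY2 Y20).
- exact: (@ge0_emeasurable_sum _ _ R D (fun i y => (lam i * e i y ^+ 2)%:E) xpredT
    (fun k x _ _ => g0 k x) (fun k _ => mg k)).
- by move=> y _; exact: integral_ge0.
- by move=> y _; exact: nneseries_ge0.
- have := Lfun2_section (Lfun2_swap Y2); apply: filterS => y yY _.
  rewrite -(section_energyE yY); apply: lime_le; first exact: is_cvg_nneseries.
  by apply: nearW => n; rewrite sumEFin big_mkord lee_fin; exact: section_bessel.
- rewrite fE integral_nneseries// -(hs_trace_energy Y2 Y0 eo ecv).
  apply: eq_eseriesr => i _; rewrite elam eo eqxx.
  under eq_integral do rewrite EFinM.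
  rewrite ge0_integralZl//.
  + by rewrite -L2form_sqrE eo eqxx.
  + by apply/measurable_EFinP; apply: measurable_funX; exact: measurable_funTS.
  + by move=> y _; rewrite lee_fin sqr_ge0.
  + by rewrite lee_fin.
- by rewrite fE; exact: hs_energy_lty Y2.
Qed.

(** By [residual_on_le] the residual of [s] is at most twice its squared distance to a good section
    plus twice the residual of that section, each below [eps / 4]. *)
Lemma expansion_approx (s : sqfun m1) :
  (forall eps : R, 0 < eps -> exists y (yY : (fun x => Y (x, y)) \in Lfun m1 2%:E),
    (\int[m1]_x (Y (x, y) ^+ 2)%:E = \sum_(i <oo) (lam i * e i y ^+ 2)%:E)%E /\
    B1 (s - Lfun_Sub (lee1n 2) yY) (s - Lfun_Sub (lee1n 2) yY) < eps) ->
  sip_cvg B1 (fun n => proj_on B1 pos kl_vec n s) s.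
Proof.
move=> h eps e0; have e40 : 0 < eps / 4 by rewrite divr_gt0.
have [y [yY [/(section_expansion yY) cv sy]]] := h _ e40.
have [N hN] := cv _ e40; exists N => n /hN {}hN.
rewrite sip_sqBC.
apply: le_lt_trans (residual_on_le kl_vec_orthonormal n s (Lfun_Sub _ yY)) _.
move: hN; rewrite sip_sqBC; lra.
Qed.

End expansion.

(** * The Karhunen-Loeve expansion *)

Lemma sip_cvg_cvg_L2 (d : measure_display) (T : measurableType d) (R : realType)
    (mu : {measure set T -> \bar R}) (D : set T) (mD : measurable D)
    (u_ : nat -> sqfun mu) (u : sqfun mu) (v_ : nat -> T -> R) (v : T -> R) :
  (forall n x, D x -> v_ n x = u_ n x) -> (forall x, D x -> v x = u x) ->
  sip_cvg (L2form mu mD) u_ u -> cvg_L2 mu D v_ v.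
Proof.
move=> vu_ vu uu.
have L2E w (z : sqfun mu) : (forall x, D x -> w x = z x) -> L2 mu D w.
  move=> wz; rewrite /L2/=; have -> : w \_ D = z \_ D.
    by apply/funext => x; rewrite !patchE; case: ifPn => // /set_mem /wz.
  by apply: Lfun2_restrict => //; exact: LfunP.
split; [by move=> n; exact: L2E (vu_ n)|exact: L2E vu|].
pose b n := L2form mu mD (u_ n - u) (u_ n - u).
have bcv (eps : R) : 0 < eps -> exists N, forall n, (N <= n)%N -> b n < eps.
  exact: uu.
have NE n : ('N[mu]_2%:E[EFin \o ((v_ n \- v)%R \_ D)] =
    (Num.sqrt (b n))%:E)%E.
  rewrite unlock.
  have -> : (\int[mu]_x `|(EFin \o ((v_ n \- v)%R \_ D)) x| `^ 2)%E =
(b n)%:E.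
    rewrite L2form_sqrE [RHS]integral_mkcond; apply: eq_integral => x _.
    rewrite [LHS]/= !patchE; case: ifPn => [/set_mem Dx|_].
      by rewrite sqfunB -vu_// -vu// powR_mulrn// real_normK// num_real.
    by rewrite normr0 powR0.
  by rewrite poweR_EFin powR12_sqrt//; exact: (sip_ge0 (L2form mu mD)).
under eq_fun do rewrite NE.
have b0 n : 0 <= b n by exact: (sip_ge0 (L2form mu mD)).
clearbody b.
apply: cvg_EFin; first exact: nearW.
apply/cvgr0Pnorm_lt => eps e0; have [N hN] := bcv _ (exprn_gt0 2 e0).
exists N => // n /hN h; rewrite /= ger0_norm ?sqrtr_ge0//.
by rewrite -(@ltr_pXn2r _ 2) ?nnegrE ?sqrtr_ge0 ?(ltW e0)// sqr_sqrtr.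
Qed.

(** Otherwise a part of [D] of positive measure would lie in the exceptional null set. *)
Lemma support_witness (R : realType) (D : set (measurableTypeR R)) (G : set R)
    (t r : R) : measurable D -> in_own_support D -> D t -> 0 < r ->
  {ae (@lebesgue_measure R), forall s, D s -> G s} ->
  exists s, [/\ D s, ball t r s & G s].
Proof.
move=> mD suppD Dt r0 [N [mN N0 NG]]; apply: contrapT => h.
have DN : D `&` ball t r `<=` N.
  by move=> s [Ds sr]; apply: NG => /= /(_ Ds) Gs; apply: h; exists s.
have := suppD t Dt r r0; apply/negP; rewrite -leNgt -N0.
apply: le_measure; rewrite ?inE//.
by apply: measurableI => //; exact: measurable_ball.
Qed.

Section karhunen_loeve.
Context (R : realType) (d : measure_display) (T : measurableType d)
  (P : probability T R) (D : set (measurableTypeR R)) (X : R -> T -> R).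
Local Notation mu := (@lebesgue_measure R).
Hypothesis mD : measurable D.
Hypothesis X2 : process_L2 P D X.

(** Extension by 0 outside [D] supplies the hypothesis [Y0] of the operator theory. *)
Definition process_kernel (wt : T * measurableTypeR R) : R :=
  ((fun wt : T * measurableTypeR R => X wt.2 wt.1) \_ (setT `*` D)) wt.

Let Y := process_kernel.

Lemma process_kernelE w t : D t -> Y (w, t) = X t w.
Proof. by move=> Dt; rewrite /Y /process_kernel patchE mem_set. Qed.

Lemma process_kernel0 w t : ~ D t -> Y (w, t) = 0.
Proof. by move=> Dt; rewrite /Y /process_kernel patchE memNset// => -[]. Qed.

Lemma process_kernel_section t : D t -> (fun w => Y (w, t)) = X t.
Proof. by move=> Dt; apply/funext => w; rewrite process_kernelE. Qed.

Lemma process_kernel_Lfun2 : Y \in Lfun (P \x mu)%E 2%:E.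
Proof. exact: X2. Qed.

Local Notation Y2 := process_kernel_Lfun2.
Local Notation B1 := (L2form P measurableT).
Local Notation B2 := (L2form mu mD).

Lemma expectationM (f g : sqfun P) :
  ('E_P[(f : T -> R) * (g : T -> R)] = (B1 f g)%:E)%E.
Proof. by rewrite unlock L2formE. Qed.

Let one : sqfun P := Lfun_Sub (lee1n 2) (Lfun_cst P 1 2).

Lemma expectation_form (f : sqfun P) : ('E_P[f] = (B1 one f)%:E)%E.
Proof.
by rewrite unlock L2formE; apply: eq_integral => w _; rewrite /= mul1r.
Qed.

(** Moving [A] to the other side leaves [A^* 1], which at [t] in [D] is the mean of [X t]. *)
Lemma hsA_centered u : centered P D X -> B1 one (hsA Y2 u) = 0.
Proof.
move=> cX; rewrite -(hsB_adj Y2 mD process_kernel0).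
rewrite /= (@eq_Rintegral _ _ _ _ _ (cst 0)) ?Rintegral_cst ?mul0r// => t /set_mem Dt.
rewrite /hs_adj [X in X * _](_ : _ = 0) ?mul0r//.
have := cX t Dt; rewrite unlock /Rintegral => /(congr1 fine) /= <-; congr fine.
by apply: eq_integral => w _; rewrite mulr1 -/Y process_kernelE.
Qed.

Lemma KL_coefE (u : sqfun mu) (l : R) :
  KL_coef D X l u = (Num.sqrt l)^-1 *: hsA Y2 u :> (T -> R).
Proof.
apply/funext => w; rewrite sqfunZ /KL_coef; congr (_ * _).
rewrite [LHS]Rintegral_mkcond; apply: eq_Rintegral => t _.
rewrite patchE -/Y; case: ifPn => [/set_mem Dt|].
  by rewrite process_kernelE.
by rewrite notin_setE => Dt; rewrite process_kernel0// mul0r.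
Qed.

Section ms_continuous_process.
Hypothesis suppD : in_own_support D.
Hypothesis procX : stochastic_process D X.
Hypothesis contX : ms_continuous P D X.

Lemma ms_near t (eps : R) : D t -> 0 < eps -> exists2 r : R, 0 < r &
  forall s, ball t r s -> D s -> (\int[P]_w ((X s w - X t w) ^+ 2)%:E < eps%:E)%E.
Proof.
move=> Dt e0; have := contX Dt.
have n0 : nbhs (0%E : \bar R) [set y | (y < eps%:E)%E].
  by apply: open_nbhs_nbhs; split; [exact: open_ereal_lt_ereal|rewrite /= lte_fin].
move=> /(_ _ n0); rewrite /within /= => /nbhs_ballP[r /= r0 h].
exists r => // s sr Ds; have := h s sr Ds; rewrite unlock; exact.
Qed.

(** By Fubini [X s] is square integrable for almost every [s] in [D]. Some such [s] is close enough
    to [t] that [X t - X s] is square integrable as well. *)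
Lemma process_Lfun2 t : D t -> X t \in Lfun P 2%:E.
Proof.
move=> Dt; have [r r0 h] := ms_near Dt ltr01.
have [s [Ds sr]] := support_witness mD suppD Dt r0
  (filterS (fun s hs (_ : D s) => hs) (Lfun2_section (Lfun2_swap Y2))).
rewrite /= -/Y process_kernel_section// => Xs.
have -> : X t = (fun w => X s w + (X t w - X s w)).
  by apply/funext => w; rewrite addrCA subrr addr0.
apply: Lfun2D => //; apply/Lfun2P; split.
  by apply: measurable_funB; exact: procX.
apply: lt_trans (ltry 1); apply: le_lt_trans (h s sr Ds).
rewrite le_eqVlt; apply/orP; left; apply/eqP; apply: eq_integral => w _.
by rewrite -sqrrN opprB.
Qed.

(** The adjoint identity [hs_adjE] with [g = X s] exchanges expectation and integration, at every
    [s] in [D]. *)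
Lemma autocorrelation_op_hsK (u : sqfun mu) s : D s ->
  autocorrelation_op P D X u s = hsK Y2 u s.
Proof.
move=> Ds.
have -> : hsK Y2 u s = \int[P]_w (X s w * hs_op mu Y u w).
  by apply: eq_Rintegral => w _; rewrite -/Y process_kernelE.
rewrite -(hs_adjE Y2 (process_Lfun2 Ds) (LfunP u)) /autocorrelation_op Rintegral_mkcond.
apply: eq_Rintegral => t _; rewrite patchE; case: ifPn => [/set_mem Dt|].
  congr (_ * _); rewrite /autocorrelation unlock /hs_adj /Rintegral.
  congr fine; apply: eq_integral => w _.
  by rewrite -/Y process_kernelE// mulrC.
rewrite notin_setE => Dt; rewrite /hs_adj.
rewrite (@eq_Rintegral _ _ _ _ _ (cst 0)) ?Rintegral_cst ?mul0r// => w _.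
by rewrite -/Y process_kernel0// mul0r.
Qed.

End ms_continuous_process.
End karhunen_loeve.

Section conclusion.
Context (R : realType) (d : measure_display) (T : measurableType d)
  (P : probability T R) (D : set (measurableTypeR R)) (X : R -> T -> R).
Local Notation mu := (@lebesgue_measure R).
Hypothesis mD : measurable D.
Hypothesis X2 : process_L2 P D X.
Local Notation Y2 := (process_kernel_Lfun2 X2).
Local Notation B1 := (L2form P measurableT).
Local Notation B2 := (L2form mu mD).

Lemma sqfun_orthonormal_basis (e : nat -> sqfun mu) :
  (forall i j, B2 (e i) (e j) = (i == j)%:R) ->
  (forall u, sip_cvg B2 (fun n => \sum_(i < n) B2 u (e i) *: e i) u) ->
  orthonormal_basis D e.
Proof.
move=> eo ecv; split => [i|i j|u Du].
- by apply: Lfun2_restrict => //; exact: LfunP.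
- exact: eo.
(* Only the restriction of [u] to [D] is square integrable, so the vector expanded is its extension
   by 0. *)
- pose us : sqfun mu := Lfun_Sub (lee1n 2) Du.
  have usE t : D t -> u t = us t by move=> Dt; rewrite /= patchE mem_set.
  apply: (sip_cvg_cvg_L2 (mD := mD) _ usE (ecv us)) => n t Dt.
  rewrite sqfun_sum; apply: eq_bigr => i _; rewrite sqfunZ; congr (_ * _).
  by apply: eq_Rintegral => s /set_mem Ds; rewrite usE.
Qed.

Lemma covariance_form (f g : sqfun P) : ('E_P[f] = 0)%E -> ('E_P[g] = 0)%E ->
  covariance P f g = (B1 f g)%:E.
Proof.
move=> f0 g0.
have P1 : P [set: T] \is a fin_num by rewrite probability_setT.
have L1 (h : sqfun P) : (h : T -> R) \in Lfun P 1.
  by apply: Lfun_subset12 => //; exact: LfunP.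
rewrite covarianceE ?f0 ?g0 ?mule0 ?sube0//; first exact: expectationM.
by apply: Lfun2_mul_Lfun1; exact: LfunP.
Qed.

Hypothesis suppD : in_own_support D.
Hypothesis procX : stochastic_process D X.
Hypothesis centX : centered P D X.
Hypothesis contX : ms_continuous P D X.

Lemma karhunen_loeve : D !=set0 ->
  exists (e : nat -> R -> R) (lambda : nat -> R),
    let xi i := KL_coef D X (lambda i) (e i) in
    [/\ orthonormal_basis D e,
        forall i, 0 <= lambda i /\
          autocorrelation_op P D X (e i)
            = (fun s => lambda i * e i s) %[ae (@lebesgue_measure R) in D],
        forall i, 0 < lambda i ->
          [/\ L2 P setT (xi i), 'E_P[xi i]%E = 0%E & 'V_P[xi i]%E = 1%E],
        forall i j, 0 < lambda i -> 0 < lambda j -> i != j ->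
          covariance P (xi i) (xi j) = 0%E &
        forall t, D t ->
          cvg_L2 P setT
            (fun n w => \sum_(i < n | 0 < lambda i)
                          Num.sqrt (lambda i) * xi i w * e i t)
            (X t)].
Proof.
move=> [t0 Dt0]; have Y0 := process_kernel0 X (D := D).
have [g gsep] := L2_separating mD.
have hinf := L2_orthonormal_family mD (suppD Dt0).
have [e [lam [eo ecv lam0 elam epw]]] := hs_eigenbasis Y2 Y0 gsep hinf.
pose kl := kl_vec Y2 e lam.
have xiE i : KL_coef D X (lam i) (e i) = kl i :> (T -> R) by exact: KL_coefE.
have klo i j : 0 < lam i -> 0 < lam j -> B1 (kl i) (kl j) = (i == j)%:R.
  exact: (kl_vec_orthonormal Y0 eo lam0 elam).
have kl0 i : ('E_P[kl i] = 0)%E.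
  by rewrite expectation_form sipZr (hsA_centered mD)// mulr0.
exists (fun i => e i), lam; split.
- exact: sqfun_orthonormal_basis.
- move=> i; split; first exact: lam0.
  have /L2form_eq0P : B2 (hsK Y2 (e i) - lam i *: e i) (hsK Y2 (e i) - lam i *: e i) = 0.
    by rewrite sipBl sipZl elam subrr.
  apply: filterS => s h Ds; rewrite (autocorrelation_op_hsK mD X2 suppD)//.
  by have /eqP := h Ds; rewrite sqfunB sqfunZ subr_eq0 => /eqP.
- move=> i li; rewrite xiE; split.
  + by apply: Lfun2_restrict => //; exact: LfunP.
  + exact: kl0.
  + by rewrite /variance covariance_form// klo// eqxx.
- by move=> i j li lj ij; rewrite !xiE covariance_form// klo// (negPf ij).
- move=> t Dt.
  have yY s : D s -> (fun w => process_kernel D X (w, s)) \in Lfun P 2%:E.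
    by move=> Ds; rewrite process_kernel_section//; exact: (process_Lfun2 mD X2).
  pose s := Lfun_Sub (lee1n 2) (yY t Dt).
  have cv : sip_cvg B1 (fun n => proj_on B1 (fun i => 0 < lam i) kl n s) s.
    apply: (expansion_approx Y0 eo lam0 elam epw) => eps e0.
    have [r r0 h] := ms_near contX Dt e0.
    (* The energy identity holds almost everywhere in [D], hence at some [s'] within the radius that
       mean-square continuity gives for [eps]. *)
    have [s' [Ds' sr' es']] := support_witness mD suppD Dt r0
      (ae_section_energy Y0 eo ecv lam0 elam epw).
    exists s', (yY s' Ds'); split => //.
    rewrite -lte_fin L2form_sqrE; apply: le_lt_trans (h s' sr' Ds').
    rewrite le_eqVlt; apply/orP; left; apply/eqP; apply: eq_integral => w _.
    by rewrite sqfunB/= !process_kernelE// -sqrrN opprB.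
  apply: (sip_cvg_cvg_L2 _ _ cv) => [n w _|w _]; last by rewrite /= process_kernelE.
  rewrite sqfun_sum; apply: eq_bigr => i li; rewrite sqfunZ xiE.
  rewrite (section_coef lam0 epw (yY t Dt) li).
  by rewrite mulrAC.
Qed.

End conclusion.

Theorem corollary5p5 (R : realType) (d : measure_display)
    (T : measurableType d) (P : probability T R)
    (D : set R) (X : R -> T -> R)
    (mD : measurable D) (D0 : D !=set0) (suppD : in_own_support D)
    (procX : stochastic_process D X) (centX : centered P D X)
    (contX : ms_continuous P D X) (X2 : process_L2 P D X) :
  exists (e : nat -> R -> R) (lambda : nat -> R),
    let xi i := KL_coef D X (lambda i) (e i) in
    [/\ orthonormal_basis D e,
        forall i, 0 <= lambda i /\
          autocorrelation_op P D X (e i)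
            = (fun s => lambda i * e i s) %[ae (@lebesgue_measure R) in D],
        forall i, 0 < lambda i ->
          [/\ L2 P setT (xi i), 'E_P[xi i]%E = 0%E & 'V_P[xi i]%E = 1%E],
        forall i j, 0 < lambda i -> 0 < lambda j -> i != j ->
          covariance P (xi i) (xi j) = 0%E &
        forall t, D t ->
          cvg_L2 P setT
            (fun n w => \sum_(i < n | 0 < lambda i)
                          Num.sqrt (lambda i) * xi i w * e i t)
            (X t)].
Proof. exact: (karhunen_loeve mD X2 suppD procX centX contX D0). Qed.
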